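(* Let $G$ be a compact (Hausdorff) abelian group with (discrete, additively written) Pontryagin dual $\widehat{G}$, and let $u:\widehat{G}\times\widehat{G}\to\mathbb{T}$ be a hermitian nondegenerate bicharacter with isotropy subgroup $\Delta_+:=\{\sigma\in\widehat{G} : u(\sigma,\sigma)=1\}$. Suppose further that $u(\sigma,\tau)=1$ for all $\sigma,\tau\in\Delta_+$. Then, up to equivalence (i.e. up to group isomorphism of $\widehat G$ and equivalence of bicharacters), only the following three possibilities occur: (1) $G=\{1\}$, $\widehat{G}=\{0\}$, and $u$ is the trivial bicharacter; (2) $G$ is the multiplicative group $\mathbb{Z}_2=\{1,-1\}$, $\widehat{G}$ is the additive group $\mathbb{Z}_2=\{0,1\}$ (addition mod 2), and $u=u_{\rm F}$ is the Fermi bicharacter $$u_{\rm F}(m,n)=(-1)^{mn},\qquad m,n\in\{0,1\};$$ (3) $G$ is the multiplicative Klein group $\mathbb{Z}_2\times\mathbb{Z}_2$, $\widehat{G}$ is the additive Klein group $\mathbb{Z}_2\oplus\mathbb{Z}_2$, and $u=u_{\rm K}$ is the Klein bicharacter $$u_{\rm K}(\mathbf{m},\mathbf{n})=(-1)^{m_1n_1+m_2n_2},\qquad \mathbf m=(m_1,m_2),\ \mathbf n=(n_1,n_2),\ m_i,n_i\in\{0,1\}.$$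
   Context: $\mathbb{T}$ is the unit circle group. A bicharacter on a discrete abelian group $A$ is a map $u:A\times A\to\mathbb{T}$ such that $u(\cdot,b)$ and $u(a,\cdot)$ are characters of $A$ for each fixed $b$, respectively $a$, in $A$. It is hermitian if $u(a,b)=\overline{u(b,a)}$ for all $a,b\in A$. It is nondegenerate if both $\{a\in A: u(a,b)=1\ \forall b\in A\}=\{0\}$ and $\{b\in A: u(a,b)=1\ \forall a\in A\}=\{0\}$. Two bicharacters $u_1,u_2$ on $A\times A$ are equivalent if there is a group automorphism $T$ of $A$ with $u_1(\sigma,\tau)=u_2(T(\sigma),T(\tau))$ for all $\sigma,\tau\in A$. For $u$ hermitian, the isotropy set $\Delta_+$ is a subgroup. *)

(* Defs.v *)
From HB Require Import structures.
From mathcomp Require Import all_boot all_order all_algebra.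
From mathcomp Require Import all_classical all_reals all_analysis.
From mathcomp Require Import complex.
Set Implicit Arguments.
Unset Strict Implicit.
Unset Printing Implicit Defensive.
Import Order.TTheory GRing.Theory Num.Theory numFieldNormedType.Exports.
Local Open Scope classical_set_scope.
Local Open Scope ring_scope.

(* Going through numClosedFieldType gives the complex numbers over R the
   topology of the complex modulus; R[i] alone carries no topology. *)
Definition Cplx (R : realType) : numClosedFieldType := R[i].

Definition unit_circle (R : realType) : set (Cplx R) := [set z | `|z| = 1].
Arguments unit_circle : clear implicits.

Definition is_character (R : realType) (A : zmodType) (chi : A -> Cplx R) :=
  (forall a, unit_circle R (chi a)) /\ {morph chi : a b / a + b >-> a * b}.

Definition is_continuous_character (R : realType) (G : topologicalZmodType)
    (chi : G -> Cplx R) := is_character chi /\ continuous chi.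

Section PontryaginDual.
Variables (R : realType) (G : topologicalZmodType).

Record dual := Dual {
  dual_fun :> G -> Cplx R ;
  dualP : is_continuous_character dual_fun }.

Lemma dual_eqP (s t : dual) : dual_fun s =1 dual_fun t -> s = t.
Proof.
case: s t => [f Hf] [g Hg] /= /funext fg; rewrite fg in Hf *.
by congr Dual; exact: Prop_irrelevance.
Qed.

HB.instance Definition _ := gen_eqMixin dual.
HB.instance Definition _ := gen_choiceMixin dual.

Lemma dual_fun_neq0 (s : dual) g : s g != 0.
Proof. by have [[/(_ g) s1 _] _] := dualP s; rewrite -normr_eq0 s1 oner_eq0. Qed.

Lemma dual_zero_subproof : is_continuous_character (fun _ : G => 1 : Cplx R).
Proof.
split; last by move=> g; exact: cvg_cst.
by split=> [g|g h]; rewrite /unit_circle /= ?normr1 ?mulr1.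
Qed.

Lemma dual_opp_subproof (s : dual) : is_continuous_character (fun g => (s g)^-1).
Proof.
have [[s1 sM] sc] := dualP s; split; last first.
  by move=> g; apply: cvgV; [exact: dual_fun_neq0 | exact: sc].
split=> [g|g h]; first by rewrite /unit_circle /= normfV s1 invr1.
by rewrite sM invfM.
Qed.

Lemma dual_add_subproof (s t : dual) :
  is_continuous_character (fun g => s g * t g).
Proof.
have [[s1 sM] sc] := dualP s; have [[t1 tM] tc] := dualP t.
split; last by move=> g; apply: cvgM; [exact: sc | exact: tc].
split=> [g|g h]; first by rewrite /unit_circle /= normrM s1 t1 mulr1.
by rewrite sM tM mulrACA.
Qed.

Definition dual_zero := Dual dual_zero_subproof.
Definition dual_opp s := Dual (dual_opp_subproof s).
Definition dual_add s t := Dual (dual_add_subproof s t).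

Lemma dual_addA : associative dual_add.
Proof. by move=> s t w; apply: dual_eqP => g /=; rewrite mulrA. Qed.
Lemma dual_addC : commutative dual_add.
Proof. by move=> s t; apply: dual_eqP => g /=; rewrite mulrC. Qed.
Lemma dual_add0 : left_id dual_zero dual_add.
Proof. by move=> s; apply: dual_eqP => g /=; rewrite mul1r. Qed.
Lemma dual_addN : left_inverse dual_zero dual_opp dual_add.
Proof. by move=> s; apply: dual_eqP => g /=; rewrite mulVf ?dual_fun_neq0. Qed.

HB.instance Definition _ :=
  GRing.isZmodule.Build dual dual_addA dual_addC dual_add0 dual_addN.

End PontryaginDual.
Arguments dual : clear implicits.

Section Bicharacters.
Variables (R : realType) (A : zmodType).
Implicit Types u : A -> A -> Cplx R.

Definition bicharacter u :=
  (forall b, is_character (fun a => u a b)) /\ (forall a, is_character (u a)).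

Definition hermitian_bichar u := forall a b, u a b = (u b a)^*.

Definition nondegenerate_bichar u :=
  [set a | forall b, u a b = 1] = [set 0] /\
  [set b | forall a, u a b = 1] = [set 0].

Definition isotropy u : set A := [set a | u a a = 1].

Definition bichar_equiv u1 u2 :=
  exists2 T : {additive A -> A}, bijective T &
    forall a b, u1 a b = u2 (T a) (T b).

End Bicharacters.

Definition bichar_equiv_upto_iso (R : realType) (A B : zmodType)
    (u : A -> A -> Cplx R) (v : B -> B -> Cplx R) :=
  exists2 phi : {additive B -> A}, bijective phi &
    bichar_equiv (fun m n => u (phi m) (phi n)) v.

(* G, written additively, is isomorphic as a topological group to the subset S
   of H, with the operation mul and the topology induced by H. *)
Definition topgroup_isom (G : topologicalZmodType) (H : topologicalType)
    (mul : H -> H -> H) (S : set H) :=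
  exists (f : G -> H) (g : H -> G),
    [/\ {morph f : x y / x + y >-> mul x y}, set_fun setT S f,
        cancel f g, {in S, cancel g f} &
        continuous f /\ {within S, continuous g}].

Definition mulZ2 (R : realType) : set (Cplx R) := [set 1; -1].
Arguments mulZ2 : clear implicits.

Definition fermi_bichar (R : realType) (m n : 'Z_2) : Cplx R :=
  (-1) ^+ (m * n)%N.

Definition klein_bichar (R : realType) (m n : 'Z_2 * 'Z_2) : Cplx R :=
  (-1) ^+ (m.1 * n.1 + m.2 * n.2)%N.

(* Main.v *)
Require Import Defs.
From HB Require Import structures.
From mathcomp Require Import all_boot all_order all_algebra.
From mathcomp Require Import all_classical all_reals all_analysis.
From mathcomp Require Import complex.
From mathcomp Require Import ring lra.
Set Implicit Arguments.
Unset Strict Implicit.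
Unset Printing Implicit Defensive.
Import Order.TTheory GRing.Theory Num.Theory numFieldNormedType.Exports.
Local Open Scope classical_set_scope.
Local Open Scope ring_scope.

(** The proof has two halves: an algebraic one about bicharacters on the dual,
    and an analytic one showing that the dual determines the group.

    Algebra. Write A for the dual and D for the isotropy subgroup. As u is
    hermitian, u(a,b) u(b,a) = 1, so a |-> u(a,a) is a homomorphism to {1,-1}
    with kernel D. If D = A then u is trivial, hence A = 0 by nondegeneracy.
    Otherwise fix s outside D; every element lies in D or in s + D. Since u is
    trivial on D x D, an element a of D with u(a,s) = 1 pairs trivially with
    all of A and vanishes ([isotropy_inj]). This gives 2s = 0, hence
    u(a,s) = 1 or -1 on D, and so D has at most two elements. If D = 0, then
    A = {0, s} with u(s,s) = -1, the Fermi case; if D = {0, e}, then s and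
    s + e are orthogonal with diagonal values -1, the Klein case.

    Analysis. To recover G from its finite dual it suffices that continuous
    characters separate the points of a compact Hausdorff abelian group
    ([dual_separates]). This is proved without Haar measure and without
    spectral theory.

    Let g <> 0, choose by Urysohn a continuous real f with f(0) <> f(g), and
    put h(x) = f(x + g) - f(x). Being continuous on a compact group, h is almost
    periodic, so it has a mean obtained from uniform limits of finite averages
    of translates ([almost_periodic_mean]); the correlation
    phi(a) = mean of h(x) h(x + a) is a nonzero positive definite function.

    For positive definite p with p(0) = 1, the mean of phi p is the infimum of
    the double averages of (phi p)(a - b) over finite families. It is midpoint
    convex on the compact convex set of all such p ([meanval_mid]), because
    averaging over a sum of two families can only lower it. Its maximum is
    positive, as p = phi / phi(0) shows by a pigeonhole argument
    ([diffsum_sqr_lb]). The set of maximizers is a closed face, so Zorn's lemma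
    provides a maximizer p that is an extreme point of the whole set
    ([extreme_point]). Extremality forces
    p(x + a) + p(x - a) = 2 p(a) p(x) ([extreme_dAlembert]), which makes p
    the real part of a character ([Kannappan]). Testing positivity of
    the mean of phi p on the arithmetic progressions 0, a, 2a, ... bounds
    1 - p(a) by the modulus of continuity of phi ([dAlembert_modulus]), so that
    p is continuous, and shows p(g) <> 1 ([dAlembert_separates]). *)

(** * Means of almost periodic functions *)

Section Averages.
Variables (R : realType) (G : zmodType).
Implicit Types (f g : G -> R) (s t : seq G) (m e c : R).

(** Average of the translates of f by the entries of s, counted with
    multiplicity; it is 0 when s is empty. *)
Definition avg s f x : R := (\sum_(a <- s) f (x + a)) / (size s)%:R.

(** Family of all sums; averaging over it is averaging over t, then over s. *)
Definition conv s t : seq G := [seq a + b | a <- s, b <- t].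

(** The constant m is a uniform limit of finite averages of translates of f.
    Stated as a relation, since not every function has a mean. *)
Definition is_mean f m :=
  forall e, 0 < e -> exists2 s, s != [::] & forall x, `|avg s f x - m| <= e.

(** Bochner almost periodicity: up to e in sup norm, f has finitely many
    translates. *)
Definition almost_periodic f := forall e, 0 < e ->
  exists s : seq G, forall a, exists2 b, b \in s &
    forall x, `|f (x + (a - b)) - f x| <= e.

Lemma sum_cst_seq (I : Type) (r : seq I) c : \sum_(i <- r) c = (size r)%:R * c.
Proof. by rewrite big_const_seq count_predT iter_addr_0 mulr_natl. Qed.

Lemma size_gt0R s : s != [::] -> 0 < (size s)%:R :> R.
Proof. by rewrite ltr0n lt0n size_eq0. Qed.

Lemma conv_neq0 s t : s != [::] -> t != [::] -> conv s t != [::].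
Proof. by case: s t => [|a s] [|b t]. Qed.

Lemma avg_conv s t f x : avg (conv s t) f x = avg s (avg t f) x.
Proof.
rewrite /avg /conv size_allpairs big_allpairs_dep natrM invfM mulrA -mulr_suml.
by rewrite mulrAC; congr (_ * _ * _); apply: eq_bigr => a _;
  apply: eq_bigr => b _; rewrite addrA.
Qed.

Lemma avg_convC s t f x : avg (conv s t) f x = avg t (avg s f) x.
Proof.
rewrite avg_conv /avg -!mulr_suml -!mulrA [(size s)%:R^-1 * _]mulrC; congr (_ * _).
rewrite exchange_big; apply: eq_bigr => a _; apply: eq_bigr => b _.
by rewrite addrAC.
Qed.

Lemma avg_le s f c x : s != [::] -> (forall y, f y <= c) -> avg s f x <= c.
Proof.
move=> s0 fc; rewrite /avg ler_pdivrMr ?size_gt0R// mulrC -sum_cst_seq.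
exact: ler_sum.
Qed.

Lemma avgN s f x : avg s (fun y => - f y) x = - avg s f x.
Proof. by rewrite /avg sumrN mulNr. Qed.

Lemma avgD s f g x : avg s (fun y => f y + g y) x = avg s f x + avg s g x.
Proof. by rewrite /avg big_split mulrDl. Qed.

Lemma avgZ s f c x : avg s (fun y => c * f y) x = c * avg s f x.
Proof. by rewrite /avg -mulr_sumr mulrA. Qed.

Lemma avg_ge s f c x : s != [::] -> (forall y, c <= f y) -> c <= avg s f x.
Proof.
move=> s0 fc; rewrite -lerN2 -avgN; apply: avg_le => // y.
by rewrite lerN2.
Qed.

Lemma avg_near s f c e x : s != [::] -> (forall y, `|f y - c| <= e) ->
  `|avg s f x - c| <= e.
Proof.
move=> s0 fc; rewrite ler_norml lerBrDr lerBlDr; apply/andP; split.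
  by apply: avg_ge => // y; have := fc y; rewrite ler_norml; lra.
by apply: avg_le => // y; have := fc y; rewrite ler_norml; lra.
Qed.

Lemma is_mean_uniq f m m' : is_mean f m -> is_mean f m' -> m = m'.
Proof.
move=> fm fm'; apply/eqP; rewrite -subr_eq0 -normr_le0; apply/ler_addgt0Pl => e e0.
have e2 : 0 < e / 2 by lra.
have [s s0 sP] := fm _ e2; have [t t0 tP] := fm' _ e2.
have h1 := avg_near 0 t0 sP; rewrite -avg_convC in h1.
have h2 := avg_near 0 s0 tP; rewrite -avg_conv in h2.
by move: h1 h2; rewrite !ler_norml; lra.
Qed.

Lemma is_meanD f g m m' :
  is_mean f m -> is_mean g m' -> is_mean (fun x => f x + g x) (m + m').
Proof.
move=> fm gm e e0; have e2 : 0 < e / 2 by lra.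
have [s s0 sP] := fm _ e2; have [t t0 tP] := gm _ e2.
exists (conv s t) => [|x]; first exact: conv_neq0.
rewrite avgD opprD addrACA (le_trans (ler_normD _ _))//.
have h1 := avg_near x t0 sP; rewrite -avg_convC in h1.
by have h2 := avg_near x s0 tP; rewrite -avg_conv in h2; lra.
Qed.

Lemma is_meanZ f c m : is_mean f m -> is_mean (fun x => c * f x) (c * m).
Proof.
move=> fm e e0; have c0 := normr_ge0 c.
have [s s0 sP] := fm (e / (`|c| + 1)) ltac:(by apply: divr_gt0; lra).
exists s => // x; rewrite avgZ -mulrBr normrM.
have := sP x; rewrite ler_pdivlMr; last by lra.
by have := normr_ge0 (avg s f x - m); nra.
Qed.

Lemma is_mean_cst c : is_mean (fun=> c) c.
Proof.
move=> e e0; exists [:: 0] => // x.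
by rewrite /avg big_seq1 divr1 subrr normr0 ltW.
Qed.

Lemma is_mean_shift f m a : is_mean f m -> is_mean (fun x => f (x + a)) m.
Proof.
move=> fm e e0; have [s s0 sP] := fm e e0; exists s => // x.
rewrite (_ : avg _ _ _ = avg s f (x + a)) //.
by rewrite /avg; congr (_ / _); apply: eq_bigr => b _; rewrite addrAC.
Qed.

Lemma is_mean_ge0 f m : (forall x, 0 <= f x) -> is_mean f m -> 0 <= m.
Proof.
move=> f0 fm; apply/ler_addgt0Pl => e e0; have [s s0 sP] := fm e e0.
by have := sP 0; have := avg_ge 0 s0 f0; rewrite ler_norml; lra.
Qed.

Lemma is_mean_le f g m m' :
  (forall x, f x <= g x) -> is_mean f m -> is_mean g m' -> m <= m'.
Proof.
move=> fg fm gm; rewrite -subr_ge0 addrC.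
rewrite -[- m]mulN1r; apply: is_mean_ge0 (is_meanD (is_meanZ (-1) fm) gm) => x.
by have := fg x; lra.
Qed.

Lemma is_mean_norm_le f m c :
  (forall x, `|f x| <= c) -> is_mean f m -> `|m| <= c.
Proof.
move=> fc fm; rewrite ler_norml; apply/andP; split.
  by apply: (is_mean_le _ (is_mean_cst (- c)) fm) => x; have := fc x; rewrite ler_norml; lra.
by apply: (is_mean_le _ fm (is_mean_cst c)) => x; have := fc x; rewrite ler_norml; lra.
Qed.

Lemma is_mean_sum (I : Type) (r : seq I) (F : I -> G -> R) (m : I -> R) :
  (forall i, is_mean (F i) (m i)) ->
  is_mean (fun x => \sum_(i <- r) F i x) (\sum_(i <- r) m i).
Proof.
move=> Fm; elim: r => [|i r IH].
  rewrite big_nil (_ : (fun x => _) = fun=> 0); first exact: is_mean_cst.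
  by apply/funext => x; rewrite big_nil.
rewrite big_cons (_ : (fun x => _) = fun x => F i x + \sum_(j <- r) F j x).
  exact: is_meanD.
by apply/funext => x; rewrite big_cons.
Qed.

(** A function whose translates move no more than those of h, up to a constant
    factor, inherits almost periodicity. *)
Lemma almost_periodic_dom (h g : G -> R) C : 0 < C -> almost_periodic h ->
  (forall e v, 0 <= e -> (forall x, `|h (x + v) - h x| <= e) ->
     forall x, `|g (x + v) - g x| <= C * e) ->
  almost_periodic g.
Proof.
move=> C0 aph hg e e0; have [s sP] := aph (e / C) ltac:(exact: divr_gt0).
exists s => a; have [b bs bP] := sP a; exists b => // x.
have := hg (e / C) _ ltac:(by rewrite divr_ge0 ?ltW) bP x.
by rewrite mulrCA divff ?gt_eqF// mulr1.
Qed.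

Lemma net_neq0 s (P : G -> G -> Prop) :
  (forall a, exists2 b, b \in s & P a b) -> s != [::].
Proof. by move=> /(_ 0)[b]; case: s. Qed.

Lemma almost_periodic_bounded f : almost_periodic f ->
  exists B : R, forall x, `|f x| <= B.
Proof.
move=> /(_ 1 ltr01)[s sP]; exists (\sum_(b <- s) `|f b| + 1) => x.
have [b bs /(_ b)] := sP x; rewrite subrKC => h.
rewrite (perm_big _ (perm_to_rem bs)) big_cons /=.
have : 0 <= \sum_(j <- rem b s) `|f j| by apply: sumr_ge0.
by move: h; have := ler_normD (f x - f b) (f b); rewrite subrK; lra.
Qed.

Lemma sum_osc f D s t : size s = size t -> (forall x y, f x - f y <= D) ->
  \sum_(a <- s) f a - \sum_(b <- t) f b <= (size s)%:R * D.
Proof.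
move=> + fD; elim: s t => [|a s IH] [|b t]//=.
  by rewrite !big_nil subrr mul0r.
move=> [/IH st]; rewrite !big_cons -natr1 mulrDl mul1r.
by have := fD a b; lra.
Qed.

(** The infimum d of the oscillations of averages of f is 0. Averaging further
    over an (e / 2)-net of n translates makes one of the n differences at most
    e / 2, so an oscillation D drops to ((n - 1) D + e / 2) / n. *)
Lemma almost_periodic_osc f e : almost_periodic f -> 0 < e ->
  exists2 s, s != [::] & forall x y, avg s f x - avg s f y <= e.
Proof.
move=> apf e0.
have [t tP] := apf (e / 2) ltac:(lra); have t0 := net_neq0 tP.
pose n : R := (size t)%:R; have n0 : 1 <= n.
  by rewrite ler1n lt0n size_eq0.
pose O := [set D : R | exists2 s, s != [::] &
  forall x y, avg s f x - avg s f y <= D].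
have stepO D : O D -> O (((n - 1) * D + e / 2) / n).
  move=> [s s0 sD]; exists (conv t s) => [|x y]; first exact: conv_neq0.
  rewrite !avg_conv {1 3}/avg -mulrBl ler_pdivrMr; last by lra.
  rewrite divfK; last by rewrite gt_eqF//; lra.
  have [c ct] : exists c : G, c \in t.
    by case: (t) t0 => // c ? _; exists c; exact: mem_head.
  (* b is chosen so that x + b and y + c differ by a near-period of f. *)
  have [b bt bP] := tP (y + c - x).
  have gclose : avg s f (x + b) - avg s f (y + c) <= e / 2.
    rewrite /avg -mulrBl -sumrB ler_pdivrMr ?size_gt0R// mulrC -sum_cst_seq.
    apply: ler_sum => a _; have := bP (x + b + a).
    rewrite (_ : x + b + a + _ = y + c + a); last first.
      by rewrite -[_ - x - b]addrA -opprD [x + b + a]addrC -addrA subrKC addrC.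
    by rewrite ler_norml; lra.
  rewrite (perm_big _ (perm_to_rem bt)) big_cons /=.
  rewrite (perm_big _ (perm_to_rem ct)) big_cons /=.
  have := @sum_osc (avg s f) D [seq x + a | a <- rem b t] [seq y + a | a <- rem c t].
  rewrite !size_map !size_rem// !big_map => /(_ erefl sD).
  rewrite -subn1 natrB; last by rewrite lt0n size_eq0.
  by rewrite -/n; lra.
have O0 : lbound O 0.
  by move=> D [s _ /(_ 0 0)]; rewrite subrr.
have Oinf : has_inf O.
  split; last by exists 0.
  have [B Bf] := almost_periodic_bounded apf.
  exists (2 * B); exists [:: 0] => // x y.
  rewrite /avg !big_seq1 !divr1 !addr0.
  by have := Bf x; have := Bf y; rewrite !ler_norml; lra.
have [D OD Dlt] := @inf_adherent _ O (e / (4 * n)) ltac:(by apply: divr_gt0; lra) Oinf.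
have := inf_lbound Oinf.2 (stepO _ OD).
rewrite ler_pdivlMr; last by lra.
move=> h; have {}Dlt : n * (D - inf O) < e / 4.
  have : D - inf O < e / (4 * n) by lra.
  by rewrite ltr_pdivlMr; lra.
have DO : inf O <= D by apply: inf_lbound => //; exact: Oinf.2.
have De : D <= e by nra.
by case: OD => s s0 sD; exists s => // x y; exact: le_trans (sD x y) De.
Qed.

(** The mean is the supremum of the constants lying below some average of f. *)
Lemma almost_periodic_mean f : almost_periodic f -> exists m, is_mean f m.
Proof.
move=> apf; pose E := [set c : R | exists2 s, s != [::] & forall x, c <= avg s f x].
have Eub s : s != [::] -> forall e, (forall x y, avg s f x - avg s f y <= e) ->
    forall c, E c -> c <= avg s f 0 + e.
  move=> s0 e se c [t t0 tP].
  have h : avg (conv s t) f 0 <= avg s f 0 + e.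
    rewrite avg_convC; apply: avg_le => // y.
    by have := se y 0; lra.
  apply: le_trans h; rewrite avg_conv; exact: avg_ge.
have supE : has_sup E.
  split; last first.
    have [s s0 sP] := almost_periodic_osc apf ltr01.
    by exists (avg s f 0 + 1) => c; exact: Eub.
  have [B Bf] := almost_periodic_bounded apf.
  exists (- B); exists [:: 0] => // x; apply: avg_ge => // y.
  by have := Bf y; rewrite ler_norml; lra.
exists (sup E) => e e0.
have [s s0 sP] := @almost_periodic_osc f (e / 2) apf ltac:(lra).
exists s => // x; rewrite ler_norml.
have h1 : sup E <= avg s f 0 + e / 2 by apply: ge_sup => [|c]; [exact: supE.1|exact: Eub].
have h2 : avg s f x - e / 2 <= sup E.
  apply: ub_le_sup; first exact: supE.2.
  by exists s => // y; have := sP x y; lra.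
by have := sP 0 x; lra.
Qed.
End Averages.

Arguments is_mean_cst {R G} c.

(** * Positive definite functions and correlations *)

Section PositiveDefinite.
Variables (R : realType) (G : zmodType).
Implicit Types (p q phi h : G -> R) (s t : seq G) (w : seq (R * G)).

(** Quadratic form of the kernel p(x - y) on finite families of weighted points
    (weight, point). *)
Definition pdform p w : R :=
  \sum_(i <- w) \sum_(j <- w) i.1 * j.1 * p (i.2 - j.2).

(** Real positive definite functions; evenness does not follow from positivity
    for real weights, hence is required. *)
Definition posdef p := (forall x, p (- x) = p x) /\ forall w, 0 <= pdform p w.

(** The form of q on the family s with unit weights. *)
Definition diffsum q s : R := \sum_(a <- s) \sum_(b <- s) q (a - b).

Lemma diffsum_pdform q s : diffsum q s = pdform q [seq (1, a) | a <- s].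
Proof.
rewrite /diffsum /pdform big_map; apply: eq_bigr => a _; rewrite big_map.
by apply: eq_bigr => b _; rewrite !mul1r.
Qed.

Lemma posdef_bound p x : posdef p -> `|p x| <= p 0.
Proof.
move=> [pN pp]; have := pp [:: (1, x); (1, 0)]; have := pp [:: (1, x); (-1, 0)].
rewrite /pdform !big_cons !big_nil /= !subrr !subr0 sub0r pN.
by rewrite ler_norml; lra.
Qed.

Lemma pdform_cat p w1 w2 : pdform p (w1 ++ w2) = pdform p w1 + pdform p w2 +
  \sum_(i <- w1) \sum_(j <- w2) i.1 * j.1 * (p (i.2 - j.2) + p (j.2 - i.2)).
Proof.
rewrite /pdform big_cat /=.
under eq_bigr do rewrite big_cat /=.
under [X in _ + X = _]eq_bigr do rewrite big_cat /=.
rewrite !big_split /= [X in _ + (X + _)]exchange_big /=.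
under [X in _ = _ + X]eq_bigr do (under eq_bigr do rewrite mulrDr; rewrite big_split /=).
rewrite big_split /=.
under [X in _ + (X + _)]eq_bigr do under eq_bigr do rewrite [_.1 * _.1]mulrC.
ring.
Qed.

Lemma pdform_lin f g (c d : R) w :
  pdform (fun x => c * f x + d * g x) w = c * pdform f w + d * pdform g w.
Proof.
rewrite /pdform !mulr_sumr -big_split /=; apply: eq_bigr => i _.
rewrite !mulr_sumr -big_split /=; apply: eq_bigr => j _; ring.
Qed.

Lemma pdformZ f (c : R) w : pdform (fun x => c * f x) w = c * pdform f w.
Proof.
rewrite /pdform mulr_sumr; apply: eq_bigr => i _.
rewrite mulr_sumr; apply: eq_bigr => j _; ring.
Qed.

Lemma pdform_shift_sym p a w : (forall x, p (- x) = p x) ->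
  pdform (fun x => p (x - a)) w = pdform (fun x => p (x + a)) w.
Proof.
move=> pN; rewrite /pdform exchange_big; apply: eq_bigr => i _.
apply: eq_bigr => j _; rewrite [j.1 * _]mulrC -pN.
by rewrite opprD opprB opprK.
Qed.

Lemma posdef_translates p a (e : R) w : posdef p -> e ^+ 2 = 1 ->
  0 <= pdform (fun x => 2 * p x + e * (p (x + a) + p (x - a))) w.
Proof.
move=> [pN pp] e1.
rewrite (_ : (fun x => _) =
    fun x => 2 * p x + e * (1 * p (x + a) + 1 * p (x - a))); last first.
  by apply/funext => x; rewrite !mul1r.
(* Test p on w together with its translate by a, whose weights carry e. *)
have := pp (w ++ [seq (e * i.1, i.2 + a) | i <- w]).
rewrite pdform_cat !pdform_lin pdform_shift_sym// !mul1r.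
set P := pdform p w.
rewrite (_ : pdform p (map _ _) = P); last first.
  rewrite /P /pdform big_map; apply: eq_bigr => i _; rewrite big_map.
  by apply: eq_bigr => j _ /=; rewrite opprD addrACA subrr addr0 mulrACA -expr2 e1 mul1r.
rewrite (_ : \sum_(i <- w) _ = e * (pdform (fun x => p (x - a)) w + pdform (fun x => p (x - a)) w)).
  by rewrite -(pdform_shift_sym a)//; lra.
rewrite /pdform -big_split mulr_sumr; apply: eq_bigr => i _.
rewrite -big_split big_map mulr_sumr; apply: eq_bigr => j _ /=.
by rewrite -(pN (j.2 + a - i.2)) opprB opprD addrA; ring.
Qed.

(** phi is the autocorrelation of h: phi(a) is the mean of h(x) h(x + a). *)
Definition correlation h phi := forall a, is_mean (fun x => h x * h (x + a)) (phi a).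

Section Correlation.
Variables (h phi : G -> R) (B : R).
Hypotheses (apH : almost_periodic h) (hB : forall x, `|h x| <= B).
Hypothesis hphi : correlation h phi.

Lemma correlation_even x : phi (- x) = phi x.
Proof.
apply: (is_mean_uniq (is_mean_shift x (hphi (- x)))).
rewrite (_ : (fun _ => _) = fun y => h y * h (y + x)); first exact: hphi.
by apply/funext => y; rewrite addrK mulrC.
Qed.

(** A special case of Schur's product theorem: the form of phi p is the mean over
    x of the form of p with weights multiplied by the values of h. *)
Lemma correlation_posdefM p : posdef p -> posdef (fun x => phi x * p x).
Proof.
move=> [pN pp]; split=> [x|w]; first by rewrite correlation_even pN.
pose F x := pdform p [seq (i.1 * h (x + i.2), i.2) | i <- w].
apply: (@is_mean_ge0 _ _ F) => [x|]; first exact: pp.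
rewrite (_ : F = fun x => \sum_(i <- w) \sum_(j <- w)
    (i.1 * j.1 * p (i.2 - j.2)) * (h (x + j.2) * h (x + j.2 + (i.2 - j.2)))).
  apply: is_mean_sum => i; apply: is_mean_sum => j.
  rewrite [X in is_mean _ X](_ : _ = (i.1 * j.1 * p (i.2 - j.2)) * phi (i.2 - j.2)); last by rewrite /=; ring.
  apply: is_meanZ; exact: is_mean_shift (hphi (i.2 - j.2)).
apply/funext => x; rewrite /F /pdform big_map; apply: eq_bigr => i _.
rewrite big_map /=; apply: eq_bigr => j _.
by rewrite -[x + j.2 + _]addrA subrKC; ring.
Qed.

(** The correlation is uniformly continuous when h is, with B times its modulus. *)
Lemma correlation_shift e v : (forall x, `|h (x + v) - h x| <= e) ->
  forall x, `|phi (x + v) - phi x| <= B * e.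
Proof.
move=> hv x; apply: (@is_mean_norm_le _ _ (fun y => h y * h (y + (x + v)) + -1 * (h y * h (y + x)))).
  move=> y; rewrite mulN1r -mulrBr normrM; apply: ler_pM => //.
  by rewrite addrA.
by rewrite -[- phi x]mulN1r; apply: is_meanD => //; apply: is_meanZ.
Qed.

Lemma correlation_gt0 g : h g != 0 -> 0 < phi 0.
Proof.
move=> hg; pose e := `|h g| / 2.
have e0 : 0 < e by rewrite divr_gt0// normr_gt0.
have [t tP] := apH e0; have t0 := net_neq0 tP.
suff : e ^+ 2 <= (size t)%:R * phi 0.
  by move=> /(lt_le_trans (exprn_gt0 _ e0)); rewrite pmulr_rgt0// size_gt0R.
rewrite -sum_cst_seq; apply: (is_mean_le _ (is_mean_cst (e ^+ 2))); last first.
  by apply: is_mean_sum => b; exact: is_mean_shift (hphi 0).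
move=> x; have [b bt /(_ (x + b))] := tP (g - x).
rewrite -[g - x - b]addrA -opprD subrKC => hb.
rewrite (perm_big _ (perm_to_rem bt)) /= big_cons addr0.
apply: ler_wpDr.
  by apply: sumr_ge0 => c _; rewrite addr0 -expr2 sqr_ge0.
have : e <= `|h (x + b)|.
  have := ler_distD (h (x + b)) (h g) 0; rewrite !subr0.
  by move: hb; rewrite /e; lra.
by rewrite -expr2 -(real_normK (num_real (h (x + b)))); nra.
Qed.
End Correlation.

Lemma correlation_exists h : almost_periodic h -> exists phi, correlation h phi.
Proof.
move=> apH; have [B hB] := almost_periodic_bounded apH.
suff /choice[phi phiP] : forall a, exists m, is_mean (fun x => h x * h (x + a)) m by exists phi.
move=> a.
apply: almost_periodic_mean; apply: (@almost_periodic_dom _ _ h _ (2 * (`|B| + 1))) => //.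
move=> e v e0 hv x.
have hb y : `|h y| <= `|B| + 1 by have := hB y; have := ler_norm B; lra.
rewrite (_ : _ - _ = h (x + v) * (h (x + a + v) - h (x + a)) + h (x + a) * (h (x + v) - h x)); last first.
  by rewrite [x + v + a]addrAC; ring.
apply: le_trans (ler_normD _ _) _; rewrite !normrM.
have := hb (x + v); have := hb (x + a); have := hv x; have := hv (x + a).
have := normr_ge0 (h (x + v)); have := normr_ge0 (h (x + a)).
have := normr_ge0 (h (x + v) - h x); have := normr_ge0 (h (x + a + v) - h (x + a)).
set A1 := `|h (x + v)|; set A2 := `|_ - _|; set A3 := `|_ - _|; set A4 := `|h (x + a)|.
set C := `|B| + 1 => *.
have : A1 * A2 <= C * e by apply: ler_pM.
have : A4 * A3 <= C * e by apply: ler_pM.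
lra.
Qed.

(** Replacing s by sums of s and t does not increase the normalized double sum:
    the function Q below is positive definite, hence maximal at 0. *)
Lemma posdef_diffsum_conv q s t : posdef q ->
  diffsum q (conv s t) <= (size t)%:R ^+ 2 * diffsum q s.
Proof.
move=> [qN qq].
pose Q x := \sum_(a <- s) \sum_(b <- s) q (a - b + x).
have Q0 x : Q x <= Q 0.
  have := qq ([seq (1, a) | a <- s] ++ [seq (-1, a - x) | a <- s]).
  rewrite pdform_cat.
  have -> : pdform q [seq (1, a) | a <- s] = Q 0.
    rewrite -diffsum_pdform; apply: eq_bigr => a _; apply: eq_bigr => b _.
    by rewrite addr0.
  have -> : pdform q [seq (-1, a - x) | a <- s] = Q 0.
    rewrite /pdform big_map; apply: eq_bigr => a _; rewrite big_map.
    by apply: eq_bigr => b _ /=; rewrite opprD addrACA subrr mulrNN !mul1r.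
  suff -> : \sum_(i <- [seq (1, a) | a <- s]) \sum_(j <- [seq (-1, a - x) | a <- s])
    i.1 * j.1 * (q (i.2 - j.2) + q (j.2 - i.2)) = - (Q x + Q x) by lra.
  rewrite big_map opprD -!sumrN -big_split; apply: eq_bigr => a _.
  rewrite big_map -!sumrN -big_split; apply: eq_bigr => b _ /=.
  by rewrite -(qN (b - x - a)) !opprB addrA addrAC; ring.
have -> : diffsum q s = Q 0.
  by apply: eq_bigr => a _; apply: eq_bigr => b _; rewrite addr0.
have -> : diffsum q (conv s t) = \sum_(c <- t) \sum_(d <- t) Q (c - d).
  rewrite /diffsum /conv big_allpairs_dep exchange_big; apply: eq_bigr => c _.
  under eq_bigr do rewrite big_allpairs_dep exchange_big.
  rewrite exchange_big; apply: eq_bigr => d _; apply: eq_bigr => a _.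
  by apply: eq_bigr => b _; rewrite opprD addrACA.
rewrite expr2 -mulrA -sum_cst_seq; apply: ler_sum => c _.
by rewrite -sum_cst_seq; apply: ler_sum => d _.
Qed.

(** The Cauchy-Schwarz inequality against the constant 1. *)
Lemma sum_sqr_le (I : eqType) (r : seq I) (N : I -> R) :
  (\sum_(i <- r) N i) ^+ 2 <= (size r)%:R * \sum_(i <- r) N i ^+ 2.
Proof.
have [->|r0] := eqVneq r [::]; first by rewrite !big_nil expr0n mulr0.
set S := \sum_(i <- r) N i; set Q := \sum_(i <- r) _; pose n : R := (size r)%:R.
have n0 : 0 < n by rewrite ltr0n lt0n size_eq0.
have : 0 <= \sum_(i <- r) (n * N i - S) ^+ 2 by apply: sumr_ge0 => i _; exact: sqr_ge0.
rewrite (eq_bigr (fun i => n ^+ 2 * N i ^+ 2 + (- (2 * n * S) * N i + S ^+ 2))); last by move=> i _; ring.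
rewrite !big_split /= -!mulr_sumr sum_cst_seq -/n -/S -/Q.
rewrite (_ : _ + _ = n * (n * Q - S ^+ 2)); last by ring.
by rewrite pmulr_rge0// subr_ge0.
Qed.

(** Pigeonhole: assign to each point an element of a finite net that differs from it
    by a near-period of phi; two points of the same class have a difference x with
    phi(x) >= phi(0) / 2. *)
Lemma diffsum_sqr_lb phi : almost_periodic phi -> 0 < phi 0 ->
  exists2 d : R, 0 < d & forall s, d * (size s)%:R ^+ 2 <= diffsum (fun x => phi x ^+ 2) s.
Proof.
move=> ap p0; have [t tP] := ap (phi 0 / 4) ltac:(lra).
have [k kP] := choice (fun a => (let: ex_intro2 b bt bP := tP a in
   ex_intro _ b (conj bt bP)) : exists b, b \in t /\ forall x, `|phi (x + (a - b)) - phi x| <= phi 0 / 4).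
pose u := undup t.
have kau a : k a \in u by rewrite mem_undup (kP a).1.
have u0 : 0 < (size u)%:R :> R.
  by apply: size_gt0R; have := kau 0; case: (u).
exists ((phi 0 / 2) ^+ 2 / (size u)%:R); first by rewrite divr_gt0// exprn_gt0//; lra.
move=> s; rewrite mulrAC ler_pdivrMr//.
(* Count the points of s class by class. *)
have -> : (size s)%:R = \sum_(b <- u) \sum_(a <- s) (k a == b)%:R :> R.
  rewrite exchange_big /= -[LHS]mulr1 -sum_cst_seq; apply: eq_bigr => a _.
  rewrite (bigD1_seq (k a) (kau a) (undup_uniq t)) /=.
  by rewrite eqxx big1 ?addr0// => b; rewrite eq_sym => /negbTE ->.
apply: le_trans (ler_wpM2l (sqr_ge0 _) (sum_sqr_le _ _)) _.
rewrite mulrCA mulrC ler_pM2r//.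
have -> : \sum_(b <- u) (\sum_(a <- s) (k a == b)%:R) ^+ 2 =
   \sum_(a <- s) \sum_(a' <- s) (k a == k a')%:R :> R.
  under eq_bigr do rewrite expr2 mulr_suml.
  rewrite exchange_big; apply: eq_bigr => a _.
  under eq_bigr do rewrite mulr_sumr.
  rewrite exchange_big; apply: eq_bigr => a' _.
  rewrite (bigD1_seq (k a) (kau a) (undup_uniq t)) /=.
  rewrite eqxx mul1r [k a' == _]eq_sym big1 ?addr0// => b.
  by rewrite eq_sym => /negbTE ->; rewrite mul0r.
rewrite mulr_sumr; apply: ler_sum => a _; rewrite mulr_sumr; apply: ler_sum => b _.
have [kab|_] := eqVneq (k a) (k b); last by rewrite mulr0 sqr_ge0.
have h1 := (kP a).2 (k a - b).
have h2 := (kP b).2 (k a - b).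
rewrite [k a - b + _]addrC subrKA in h1.
rewrite subrKA kab subrr in h2.
have h3 : phi 0 / 2 <= phi (a - b) by move: h1 h2; rewrite kab !ler_norml; lra.
by rewrite mulr1 ler_sqr// nnegrE; lra.
Qed.
End PositiveDefinite.

(** * Extreme positive definite functions *)

Section Extreme.
Variables (R : realType) (G : zmodType).

(* Functions on G with the topology of pointwise convergence *)
Let F := prod_topology (fun _ : G => R).

Lemma eval_continuous (a : G) : continuous (fun p : F => p a).
Proof. by move=> p; exact: (@proj_continuous G (fun _ => R) a p). Qed.

Lemma evalZ_continuous (c : R) (a : G) : continuous (fun p : F => c * p a).
Proof.
move=> p; apply: (@continuous_comp F R R (fun p => p a) ( *%R c)).
  exact: eval_continuous.
exact: mulrl_continuous.
Qed.

Lemma continuous_sum (I : Type) (r : seq I) (f : I -> F -> R) :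
  (forall i, continuous (f i)) -> continuous (fun p => \sum_(i <- r) f i p).
Proof. by move=> fc; apply: continuous_big => //; exact: add_continuous. Qed.

Lemma pdform_continuous w : continuous (fun p : F => pdform p w).
Proof.
apply: continuous_sum => i; apply: continuous_sum => j.
exact: evalZ_continuous.
Qed.

Lemma diffsum_continuous (phi : G -> R) s :
  continuous (fun p : F => diffsum (fun x => phi x * p x) s).
Proof.
apply: continuous_sum => i; apply: continuous_sum => j.
exact: evalZ_continuous.
Qed.

(** Normalized positive definite functions, a compact convex set. *)
Definition states : set F := [set p | posdef p /\ p 0 = 1].

Lemma closed_fun_ge (f : F -> R) c : continuous f -> closed [set p | c <= f p].
Proof. by move=> cf; apply: (@closed_comp _ _ f [set x | c <= x]) => [x _|]; [exact: cf|exact: closed_ge]. Qed.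

Lemma closed_fun_eq (f : F -> R) c : continuous f -> closed [set p | f p = c].
Proof. by move=> cf; apply: (@closed_comp _ _ f [set x | x = c]) => [x _|]; [exact: cf|exact: closed_eq]. Qed.

Lemma states_closed : closed states.
Proof.
rewrite (_ : states = [set p | p 0 = 1] `&`
  ((\bigcap_(x in setT) [set p | p x - p (- x) = 0]) `&`
  \bigcap_(w in setT) [set p : F | 0 <= pdform p w])).
  apply: closedI; first by apply: closed_fun_eq; exact: eval_continuous.
  apply: closedI; apply: closed_bigI => i _.
    apply: closed_fun_eq => p.
    by apply: (@continuousB R R F (fun p => p i) (fun p => p (- i))); exact: eval_continuous.
  apply: closed_fun_ge; exact: pdform_continuous.
apply/seteqP; split=> p.
  by move=> [[pN pp] p0]; split=> //; split=> i _ //=; rewrite pN subrr.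
move=> [p0 [pN pp]]; split=> //; split=> [x|w]; last exact: pp.
by apply/esym/eqP; rewrite -subr_eq0; apply/eqP/pN.
Qed.

Lemma states_compact : compact states.
Proof.
pose I := [set p : F | forall a, `[-1, 1]%classic (p a)].
apply: (@subclosed_compact _ states I states_closed).
  by apply: (@tychonoff G (fun=> R) (fun=> `[-1, 1]%classic)) => a; exact: segment_compact.
move=> p [pp p0] a /=; rewrite in_itv/= -ler_norml -p0; exact: posdef_bound.
Qed.

(** S absorbs the endpoints of segments of K whose midpoint lies in S. By symmetry
    it is enough to require this of one endpoint. *)
Definition midface (K S : set F) := forall p p1 p2 : F, S p -> K p1 -> K p2 ->
  (forall x, p1 x + p2 x = 2 * p x) -> S p1.

(** A chain of nonempty closed subsets of a compact set has a common point. *)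
Lemma chain_compact (T : topologicalType) (C : set (set T)) (K : set T) :
  compact K -> C !=set0 -> total_on C subset ->
  (forall X, C X -> [/\ X `<=` K, closed X & X !=set0]) ->
  \bigcap_(X in C) X !=set0.
Proof.
move=> cK [X0 CX0] tot CP.
have PF : ProperFilter (filter_from C id).
  apply: filter_from_proper; last by move=> X /CP[].
  apply: filter_from_filter; first by exists X0.
  move=> X Y CX CY; case: (tot _ _ CX CY) => h; [exists X|exists Y] => // x; split => //; exact: h.
have [|x [Kx clx]] := cK _ PF; first by exists X0 => //; have [] := CP _ CX0.
exists x => X CX; have [_ /closure_id -> _] := CP _ CX.
by move: x clx {Kx} => x; rewrite clusterE; apply; exists X.
Qed.

(** The Krein-Milman argument: a minimal closed face inside S0 is a singleton,
    since each coordinate attains its maximum on a smaller face. *)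
Lemma extreme_point (K S0 : set F) : compact K -> S0 `<=` K -> closed S0 ->
  S0 !=set0 -> midface K S0 ->
  exists2 p, S0 p & forall p1 p2, K p1 -> K p2 ->
    (forall x, p1 x + p2 x = 2 * p x) -> p1 = p.
Proof.
move=> cK S0K clS0 S00 mS0.
pose face S := [/\ S `<=` S0, closed S, S !=set0 & midface K S].
(* Minimal faces are obtained from maximal complements relative to S0. *)
have [C CP Ctot|A [[A1 A2 A3 A4] Amax]] := @Zorn_bigcup F [set A | face (S0 `\` A)].
  have [->|/set0P[A0 CA0]] := eqVneq C set0.
    by rewrite bigcup_set0 /face /= setD0; split.
  have DE : S0 `\` \bigcup_(X in C) X = \bigcap_(X in C) (S0 `\` X).
    apply/seteqP; split=> [x [Sx nx] X CX|x h].
      by split=> // Xx; apply: nx; exists X.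
    split; first by have [] := h _ CA0.
    by move=> [X CX Xx]; have [] := h _ CX.
  rewrite /face /= DE; split.
  - by move=> x /(_ _ CA0)[].
  - by apply: closed_bigI => X /CP[].
  - rewrite (_ : \bigcap_(X in C) _ = \bigcap_(Y in [set S0 `\` X | X in C]) Y).
      apply: (@chain_compact _ _ S0).
      + exact: subclosed_compact clS0 cK S0K.
      + by exists (S0 `\` A0); exists A0.
      + move=> _ _ [X CX <-] [Y CY <-].
        by case: (Ctot _ _ CX CY) => h; [right|left]; apply: setDS.
      + by move=> _ [X /CP[]? ? ? _ <-].
    by rewrite bigcap_image.
  - move=> p p1 p2 h K1 K2 e X CX; have [_ _ _ m] := CP _ CX.
    exact: (m p p1 p2 (h _ CX) K1 K2 e).
pose S := S0 `\` A.
have Smin S' : face S' -> S' `<=` S -> S `<=` S'.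
  move=> fS' S'S p Sp; apply: contrapT => nS'p.
  apply: (Amax (~` S')).
    split; last by move=> /(_ _ nS'p); case: Sp.
    by move=> x Ax /S'S[].
  by rewrite /= setDE setCK setIidr//; case: fS'.
have cS : compact S by apply: subclosed_compact cK _ => // x [/S0K].
have Sval a p q : S p -> S q -> p a = q a.
  have [c cS' cmax] := @compact_EVT_max F R (fun p => p a) S A3 cS
    (continuous_subspaceT (eval_continuous (a := a))).
  pose S' := S `&` [set p : F | c a <= p a].
  have fS' : face S'.
    split.
    - by move=> x [/A1].
    - apply: closedI => //; apply: closed_fun_ge; exact: eval_continuous.
    - by exists c; split; [exact/set_mem|exact: lexx].
    - move=> r r1 r2 [Sr cr] K1 K2 e.
      have S1 := A4 _ _ _ Sr K1 K2 e.
      have S2 : S r2 by apply: (A4 _ _ _ Sr K2 K1) => x; rewrite addrC.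
      split=> //=; have := cmax _ (mem_set S2); have := e a; move: cr => /=; lra.
  have /(_ S' fS') := Smin; move=> /(_ (@subIsetl _ _ _)) h Sp Sq.
  have [_ /= h1] := h _ Sp; have [_ /= h2] := h _ Sq.
  by apply/eqP; rewrite eq_le; have := cmax _ (mem_set Sp); have := cmax _ (mem_set Sq); lra.
have [p Sp] := A3; exists p; first exact: A1.
move=> p1 p2 K1 K2 e; apply/funext => x.
by apply: Sval => //; exact: (A4 _ _ _ Sp K1 K2 e).
Qed.

Section Maximizer.
Variable phi : G -> R.
Hypothesis phiP : forall p, posdef p -> posdef (fun x => phi x * p x).

Let D (p : F) s := diffsum (fun x => phi x * p x) s.
Let N (s : seq G) : R := (size s)%:R ^+ 2.

(** The mean of phi p, as the infimum of normalized double sums. As an infimum of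
    continuous functions of p it is upper semicontinuous, although no continuity
    of p itself is assumed. *)
Definition meanval (p : F) : R := inf [set D p s / N s | s in [set s | s != [::]]].

Let D_ge0 p s : posdef p -> 0 <= D p s.
Proof. by move=> /phiP[_ pp]; rewrite /D diffsum_pdform. Qed.

Let N_gt0 s : s != [::] -> 0 < N s.
Proof. by move=> s0; rewrite exprn_gt0// size_gt0R. Qed.

Lemma meanval_ge p c : (forall s, s != [::] -> c * N s <= D p s) -> c <= meanval p.
Proof.
move=> h; apply: lb_le_inf; first by exists (D p [:: 0] / N [:: 0]); exists [:: 0].
by move=> _ [s s0 <-]; rewrite ler_pdivlMr ?N_gt0//; exact: h.
Qed.

Lemma meanval_le p s : posdef p -> s != [::] -> meanval p * N s <= D p s.
Proof.
move=> pp s0; rewrite -ler_pdivlMr ?N_gt0//; apply: ge_inf; last by exists s.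
by exists 0 => _ [t t0 <-]; rewrite divr_ge0 ?D_ge0// ltW// N_gt0.
Qed.

Lemma diffsum_convC (q : G -> R) s t : diffsum q (conv s t) = diffsum q (conv t s).
Proof.
rewrite /diffsum /conv !big_allpairs_dep exchange_big; apply: eq_bigr => a _.
apply: eq_bigr => b _; rewrite !big_allpairs_dep exchange_big; apply: eq_bigr => c _.
by apply: eq_bigr => d _; rewrite [b + a]addrC [d + c]addrC.
Qed.

(** This inequality makes the maximizers of [meanval] a face. Families s and t that
    are nearly optimal for p1 and p2 are both beaten by the family of their sums. *)
Lemma meanval_mid p p1 p2 : posdef p -> posdef p1 -> posdef p2 ->
  (forall x, p1 x + p2 x = 2 * p x) -> 2 * meanval p <= meanval p1 + meanval p2.
Proof.
move=> pp pp1 pp2 e; rewrite -lerBlDr; apply: meanval_ge => s s0.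
rewrite -ler_pdivlMr ?N_gt0// lerBlDl -lerBlDr; apply: meanval_ge => t t0.
rewrite mulrBl lerBlDr.
have := meanval_le pp (conv_neq0 s0 t0).
have h1 : D p1 (conv s t) <= N t * D p1 s by exact: posdef_diffsum_conv (phiP pp1).
have h2 : D p2 (conv s t) <= N s * D p2 t.
  by rewrite /D diffsum_convC; exact: posdef_diffsum_conv (phiP pp2).
have e' : D p1 (conv s t) + D p2 (conv s t) = 2 * D p (conv s t).
  rewrite /D /diffsum -big_split mulr_sumr; apply: eq_bigr => a _ /=.
  rewrite -big_split mulr_sumr; apply: eq_bigr => b _ /=.
  by rewrite mulrCA -e mulrDr.
rewrite /N size_allpairs natrM exprMn -/(N s) -/(N t) => h3.
have Ns := N_gt0 s0; have Nt := N_gt0 t0.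
have : 2 * meanval p * N t * N s <= N t * D p1 s + N s * D p2 t by lra.
rewrite -(ler_pM2r Ns) [X in _ -> _ <= X]mulrDl [_ / _ * _ * _]mulrAC divfK ?gt_eqF//.
lra.
Qed.

(** Some extreme state has at least the mean value of a given state. *)
Lemma meanval_extreme (p0 : F) : states p0 -> exists p : F, [/\ states p,
  meanval p0 <= meanval p &
  forall p1 p2, states p1 -> states p2 -> (forall x, p1 x + p2 x = 2 * p x) -> p1 = p].
Proof.
move=> Kp0.
(* C q collects the states whose mean value is at least that of q. *)
pose C q : set F := states `&` \bigcap_(s in [set s | s != [::]]) [set p | meanval q * N s <= D p s].
have CE q p : C q p <-> states p /\ meanval q <= meanval p.
  split=> [[Kp h]|[Kp qp]]; first by split=> //; apply: meanval_ge => s /h.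
  split=> // s s0 /=; apply: le_trans (meanval_le Kp.1 s0).
  by rewrite ler_pM2r// N_gt0.
have clC q : closed (C q).
  apply: closedI; first exact: states_closed.
  by apply: closed_bigI => s _; apply: closed_fun_ge; exact: diffsum_continuous.
pose S0 := \bigcap_(X in [set C q | q in states]) X.
have S0E p : S0 p <-> states p /\ forall q, states q -> meanval q <= meanval p.
  split=> [h|[Kp h] _ [q Kq <-]]; last by apply/CE; split=> //; exact: h.
  split=> [|q Kq]; first by have /CE[] := h _ (imageP C Kp0).
  by have /CE[] := h _ (imageP C Kq).
have [||||p Sp pext] := @extreme_point states S0 states_compact.
- by move=> p /S0E[].
- by apply: closed_bigI => _ [q _ <-].
- apply: (chain_compact states_compact); first by exists (C p0); exists p0.
    move=> _ _ [q Kq <-] [r Kr <-].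
    by case: (leP (meanval q) (meanval r)) => [|/ltW] qr; [right|left];
      move=> p /CE[Kp h]; apply/CE; split=> //; exact: le_trans h.
  move=> _ [q Kq <-]; split=> //; first by move=> p [].
  by exists q; apply/CE.
- move=> p p1 p2 /S0E[Kp pmax] K1 K2 e; apply/S0E; split=> // q Kq.
  apply: le_trans (pmax _ Kq) _.
  have := meanval_mid Kp.1 K1.1 K2.1 e; have := pmax _ K2; lra.
by have /S0E[Kp pmax] := Sp; exists p; split=> //; exact: pmax.
Qed.
End Maximizer.

(** p is the midpoint of p + E / 2 and p - E / 2, where
    E(x) = (p(x + a) + p(x - a)) / 2 - p(a) p(x); both are states, so that E = 0. *)
Lemma extreme_dAlembert (p : F) : states p ->
  (forall p1 p2, states p1 -> states p2 -> (forall x, p1 x + p2 x = 2 * p x) -> p1 = p) ->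
  forall x a, p (x + a) + p (x - a) = 2 * p a * p x.
Proof.
move=> [pp p0] pext x a; have [pN pw] := pp.
pose P (e : R) : F := fun x => (1 - e * p a) / 2 * p x +
  1 / 4 * (2 * p x + e * (p (x + a) + p (x - a))).
have KP e : e ^+ 2 = 1 -> states (P e).
  move=> e1; split; last by rewrite /P p0 add0r sub0r pN; lra.
  split=> [y|w].
    have pNa y' : p (- y' - a) = p (y' + a) by rewrite -pN opprB opprK addrC.
    by rewrite /P pN pNa -(pN (- y + a)) opprD opprK; lra.
  rewrite /P pdform_lin; apply: addr_ge0; apply: mulr_ge0 => //.
  - have : e * p a <= 1; last by lra.
    have := posdef_bound a pp; rewrite p0 ler_norml; nra.
  - exact: posdef_translates.
have := pext (P 1) (P (-1)) (KP _ (expr1n _ _)) (KP _ _).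
move=> /(_ ltac:(by rewrite sqrrN expr1n)) /(_ ltac:(move=> y; rewrite /P; lra)).
by move=> /(congr1 (fun f => f x)); rewrite /P; lra.
Qed.
End Extreme.

(** * Bounded solutions of d'Alembert's equation *)

Lemma natmul_unbounded (R : realType) (a b : R) :
  (forall n, (0 < n)%N -> a * n%:R <= b) -> a <= 0.
Proof.
move=> h; rewrite leNgt; apply/negP => a0.
have := h _ (ltn0Sn (Num.truncn (`|b| / a))).
rewrite leNgt => /negP; apply; rewrite mulrC -ltr_pdivrMr//.
apply: le_lt_trans (truncnS_gt _); rewrite ler_pM2r ?invr_gt0//; exact: ler_norm.
Qed.

Section DAlembert.
Variables (R : realType) (G : zmodType) (p : G -> R).
Hypotheses (p0 : p 0 = 1) (pN : forall x, p (- x) = p x) (p1 : forall x, `|p x| <= 1).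
Hypothesis dA : forall x a, p (x + a) + p (x - a) = 2 * p a * p x.

(** Summation by parts along y, y + a, ..., using that 2 (1 - p(a)) p is minus the
    second difference of p with step a. *)
Lemma dAlembert_sum (phi : G -> R) (B e : R) a n y : 0 <= e ->
  (forall x, `|phi x| <= B) -> (forall x, `|phi (x + a) - phi x| <= e) ->
  2 * (1 - p a) * (\sum_(0 <= i < n) phi (y + a *+ i) * p (y + a *+ i)) <=
  4 * B + 2 * e * n%:R.
Proof.
move=> e0 pB pe.
(* First differences; the boundary terms account for the summand 4 B. *)
pose d i : R := p (y + a *+ i) - p (y + a *+ i - a).
have dle i : `|d i| <= 2.
  by apply: le_trans (ler_normB _ _) _; rewrite -[2]/(1 + 1 : R) lerD.
have phid i j : phi i * d j <= 2 * B.
  apply: le_trans (ler_norm _) _; rewrite normrM mulrC.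
  by apply: ler_pM => //; exact: normr_ge0.
suff : 2 * (1 - p a) * (\sum_(0 <= i < n) phi (y + a *+ i) * p (y + a *+ i)) +
    phi (y + a *+ n) * d n <= 2 * B + 2 * e * n%:R.
  have : - (phi (y + a *+ n) * d n) <= 2 * B.
    apply: le_trans (ler_norm _) _; rewrite normrN normrM mulrC.
    by apply: ler_pM => //; exact: normr_ge0.
  lra.
elim: n => [|n IH].
  by rewrite big_geq// !mulr0 add0r !addr0; exact: phid.
rewrite big_nat_recr//= -natr1.
have dS : d n.+1 = d n - 2 * (1 - p a) * p (y + a *+ n).
  have := dA (y + a *+ n) a; rewrite /d [a *+ _.+1]mulrS [a + _]addrC addrA addrK; lra.
have : (phi (y + a *+ n.+1) - phi (y + a *+ n)) * d n.+1 <= 2 * e.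
  apply: le_trans (ler_norm _) _; rewrite normrM mulrC.
  apply: ler_pM; rewrite ?normr_ge0//.
  by rewrite [a *+ _.+1]mulrS [a + _]addrC addrA.
move: IH; rewrite dS; lra.
Qed.

(** The arithmetic progression 0, a, ..., (n - 1) a. *)
Definition arith (a : G) n := [seq a *+ i | i <- iota 0 n].

Lemma arith_neq0 a n : (0 < n)%N -> arith a n != [::].
Proof. by case: n. Qed.

Lemma size_arith a n : size (arith a n) = n.
Proof. by rewrite size_map size_iota. Qed.

Lemma sum_arith (f : G -> R) a n :
  \sum_(b <- arith a n) f b = \sum_(0 <= i < n) f (a *+ i).
Proof. by rewrite big_map /index_iota subn0. Qed.

(** When the mean of phi p is at least delta, 1 - p(a) is controlled by how
    much phi moves under translation by a. *)
Lemma dAlembert_modulus (phi : G -> R) (B e delta : R) a : 0 <= e ->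
  (forall x, `|phi x| <= B) -> (forall x, `|phi (x + a) - phi x| <= e) ->
  (forall s, s != [::] ->
     delta * (size s)%:R ^+ 2 <= diffsum (fun x => phi x * p x) s) ->
  delta * (1 - p a) <= e.
Proof.
move=> e0 pB pe dP; rewrite -subr_le0; apply: (@natmul_unbounded _ _ (2 * B)) => n n0.
have n0R : 0 < n%:R :> R by rewrite ltr0n.
have := dP _ (arith_neq0 a n0); rewrite size_arith => h1.
have pa1 : 0 <= 1 - p a by have := p1 a; rewrite ler_norml; lra.
have h2 : 2 * (1 - p a) * diffsum (fun x => phi x * p x) (arith a n) <=
    n%:R * (4 * B + 2 * e * n%:R).
  rewrite /diffsum exchange_big mulr_sumr.
  rewrite (_ : n%:R * _ = \sum_(b <- arith a n) (4 * B + 2 * e * n%:R)); last first.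
    by rewrite sum_cst_seq size_arith.
  apply: ler_sum => b _; rewrite sum_arith.
  under eq_bigr do rewrite addrC.
  exact: dAlembert_sum.
by rewrite -(ler_pM2l n0R); have := ler_wpM2l pa1 h1; lra.
Qed.

Lemma dAlembert_period a : p a = 1 -> forall n, p (a *+ n) = 1.
Proof.
move=> pa n; suff : p (a *+ n) = 1 /\ p (a *+ n.+1) = 1 by case.
elim: n => [|n [IH1 IH2]]; first by rewrite mulr0n mulr1n.
split=> //; have := dA (a *+ n.+1) a; rewrite -mulrSr [in _ - a]mulrSr addrK.
by rewrite IH1 IH2 pa; lra.
Qed.

(** If p(a) = 1, then p = 1 on the multiples of a, and the double sum of phi over
    0, a, ..., (n - 1) a is the mean of a telescoping square, hence bounded in n;
    this contradicts the growth delta n^2. *)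
Lemma dAlembert_separates (f phi : G -> R) (B delta : R) a : 0 < delta ->
  (forall x, `|f x| <= B) ->
  correlation (fun x => f (x + a) - f x) phi ->
  (forall s, s != [::] ->
     delta * (size s)%:R ^+ 2 <= diffsum (fun x => phi x * p x) s) ->
  p a != 1.
Proof.
move=> d0 fB cphi dP; apply/eqP => pa.
suff : delta <= 0 by lra.
apply: (@natmul_unbounded _ _ (4 * B ^+ 2)) => n n0.
have n0R : 1 <= n%:R :> R by rewrite ler1n.
have := dP _ (arith_neq0 a n0); rewrite size_arith.
suff : diffsum (fun x => phi x * p x) (arith a n) <= 4 * B ^+ 2.
  have : 0 <= delta * n%:R * (n%:R - 1) by apply: mulr_ge0; [apply: mulr_ge0; lra|lra].
  lra.
(* The sum of the translates of x |-> f(x + a) - f(x) telescopes. *)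
pose H x := \sum_(b <- arith a n) (f (x + b + a) - f (x + b)).
have HE x : H x = f (x + a *+ n) - f x.
  rewrite /H sum_arith.
  under eq_bigr do rewrite -addrA -mulrSr.
  by rewrite (telescope_sumr (fun i => f (x + a *+ i))) ?mulr0n ?addr0.
have HB x : H x * H x <= 4 * B ^+ 2.
  rewrite HE; have := fB (x + a *+ n); have := fB x.
  set u := f _; set v := f _; rewrite !ler_norml => fu fv.
  have : 0 <= (2 * B - (v - u)) * (2 * B + (v - u)) by apply: mulr_ge0; lra.
  lra.
have pdiff b c : b \in arith a n -> c \in arith a n -> p (b - c) = 1.
  move=> /mapP[i _ ->] /mapP[j _ ->].
  case: (leqP i j) => [ij|/ltnW ij]; last by rewrite -mulrnBr// dAlembert_period.
  by rewrite -pN opprB -mulrnBr// dAlembert_period.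
apply: (is_mean_le HB _ (is_mean_cst _)).
rewrite (_ : diffsum _ _ = \sum_(b <- arith a n) \sum_(c <- arith a n) phi (b - c)).
  rewrite (_ : (fun x => _) = fun x => \sum_(b <- arith a n) \sum_(c <- arith a n)
     (f (x + c + a) - f (x + c)) * (f (x + c + (b - c) + a) - f (x + c + (b - c)))).
    apply: is_mean_sum => b; apply: is_mean_sum => c.
    exact: is_mean_shift (cphi (b - c)).
  apply/funext => x; rewrite /H mulr_suml; apply: eq_bigr => b _.
  rewrite mulr_sumr; apply: eq_bigr => c _.
  by rewrite -[x + c + (b - c)]addrA subrKC mulrC.
rewrite /diffsum; apply: eq_big_seq => b bs; apply: eq_big_seq => c cs.
by rewrite pdiff// mulr1.
Qed.

(** A bounded even solution of d'Alembert's equation is a cosine: it satisfies the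
    addition formulas together with a sine s. If p(a)^2 <> 1, the sine is
    recovered from p(x - a) - p(x + a) = 2 s(x) s(a); if p^2 = 1 everywhere,
    then s = 0. *)
Lemma Kannappan : exists s : G -> R,
  [/\ forall x y, p (x + y) = p x * p y - s x * s y,
      forall x y, s (x + y) = s x * p y + p x * s y &
      forall x, p x ^+ 2 + s x ^+ 2 = 1].
Proof.
have [[a pa]|/forallNP h] := pselect (exists a, p a ^+ 2 <> 1); last first.
  have {}h a : p a ^+ 2 = 1 by apply: contrapT.
  exists (fun=> 0); split=> [x y|x y|x]; rewrite ?mulr0 ?mul0r ?subr0 ?addr0 ?expr0n ?addr0//.
  have := dA x y; have := p1 (x + y); have := p1 (x - y); rewrite !ler_norml.
  have : (p x * p y) ^+ 2 = 1 by rewrite exprMn !h mulr1.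
  by move/eqP; rewrite sqrf_eq1 => /orP[] /eqP; lra.
pose t := 1 - p a ^+ 2.
have t0 : 0 < t.
  rewrite subr_gt0 lt_neqAle; apply/andP; split; first exact/eqP.
  have := p1 a; rewrite ler_norml => pa1.
  by have : 0 <= (1 - p a) * (1 + p a) by [apply: mulr_ge0; lra]; lra.
pose r := Num.sqrt t; have r0 : r != 0 by rewrite sqrtr_eq0 -ltNge.
have r2 : r ^+ 2 = t by rewrite sqr_sqrtr// ltW.
pose s x := (p (x - a) - p (x + a)) / (2 * r).
have pD x y : p (x - y) - p (x + y) = 2 * s x * s y.
  have e1 := dA (x - a) (y - a).
  have e2 := dA (x - a) (y + a).
  have e3 := dA (x + a) (y - a).
  have e4 := dA (x + a) (y + a).
  have e5 := dA (x + y) (a + a).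
  have e6 := dA (x - y) (a + a).
  have e7 := dA a a; rewrite subrr p0 in e7.
  have E1 : x - a + (y - a) = x + y - (a + a) by rewrite opprD addrACA.
  have E2 : x - a - (y - a) = x - y by rewrite opprB addrA subrK.
  have E3 : x - a + (y + a) = x + y by rewrite [y + a]addrC addrA subrK.
  have E4 : x - a - (y + a) = x - y - (a + a) by rewrite opprD addrACA -opprD.
  have E5 : x + a + (y - a) = x + y by rewrite [y - a]addrC addrA addrK.
  have E6 : x + a - (y - a) = x - y + (a + a) by rewrite opprB addrA -[x + a + a]addrA addrAC.
  have E7 : x + a + (y + a) = x + y + (a + a) by rewrite addrACA.
  have E8 : x + a - (y + a) = x - y by rewrite opprD addrACA subrr addr0.
  rewrite E1 E2 in e1; rewrite E3 E4 in e2; rewrite E5 E6 in e3; rewrite E7 E8 in e4.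
  have key : (p (x - a) - p (x + a)) * (p (y - a) - p (y + a)) = 2 * t * (p (x - y) - p (x + y)).
    rewrite (_ : p (a + a) = 2 * p a ^+ 2 - 1) in e5 e6; last by lra.
    by rewrite /t; lra.
  rewrite /s (_ : 2 * _ * _ = (p (x - a) - p (x + a)) * (p (y - a) - p (y + a)) / (2 * r ^+ 2)); last by field.
  by rewrite key r2; field; exact: lt0r_neq0.
have pM x y : p (x + y) = p x * p y - s x * s y.
  by have := dA x y; have := pD x y; lra.
exists s; split=> //.
- have sA x y : s (x + y) + s (x - y) = 2 * s x * p y.
    rewrite /s; have e1 := dA (x - a) y; have e2 := dA (x + a) y.
    rewrite (_ : x + y - a = x - a + y) 1?addrAC// (_ : x - y - a = x - a - y) 1?addrAC//.
    rewrite (_ : x + y + a = x + a + y) 1?addrAC// (_ : x - y + a = x + a - y) 1?addrAC//.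
    have -> : p (x - a + y) = 2 * p y * p (x - a) - p (x - a - y) by lra.
    have -> : p (x + a + y) = 2 * p y * p (x + a) - p (x + a - y) by lra.
    by field.
  have sN x : s (- x) = - s x.
    by rewrite /s -[p (- x + a)]pN -[p (- x - a)]pN !opprD !opprK; field.
  move=> x y; have := sA x y; have := sA y x.
  by rewrite [y + x]addrC -[y - x]opprB sN; lra.
- move=> x; have := pM x (- x); have := pD x x; rewrite subrr p0.
  by have := dA x x; rewrite subrr p0; lra.
Qed.
End DAlembert.

(** * Continuous characters separate points *)

Section Separation.
Variables (R : realType) (G : topologicalZmodType).
Hypotheses (G_compact : compact [set: G]) (G_hausdorff : hausdorff_space G).

(** Uniform continuity, by a tube argument near G x {0}. *)
Lemma uniformly_continuous (f : G -> R) (e : R) : continuous f -> 0 < e ->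
  \forall v \near (0 : G), forall x, `|f (x + v) - f x| <= e.
Proof.
move=> cf e0.
have /compact_near_coveringP cov := G_compact.
pose P (v x : G) := `|f (x + v) - f x| <= e.
apply: (filterS _ (cov G (nbhs (0 : G)) P (nbhs_filter _) _)) => [v h x|x _].
  exact: h.
have cg : {for (x, 0 : G), continuous (fun z : G * G => f (z.1 + z.2) - f z.1)}.
  apply: (@continuousB R R (G * G)%type (fun z => f (z.1 + z.2)) (fun z => f z.1)).
    apply: (@continuous_comp _ _ _ (fun z : G * G => z.1 + z.2) f).
      exact: add_continuous.
    exact: cf.
  apply: (@continuous_comp _ _ _ (fun z : G * G => z.1) f); first exact: cvg_fst.
  exact: cf.
have /cvgrPdist_le/(_ e e0) := cg.
rewrite /= addr0 subrr; apply: filterS => z.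
by rewrite sub0r normrN.
Qed.

Lemma continuous_almost_periodic (f : G -> R) : continuous f -> almost_periodic f.
Proof.
move=> cf e e0.
have /compact_near_coveringP cov := G_compact.
(* Finite families ordered by inclusion: near Fl, a family is large enough. *)
pose Fl : set_system (seq G) := filter_from setT (fun s : seq G => [set t : seq G | {subset s <= t}]).
have FF : Filter Fl.
  apply: filter_from_filter; first by exists [::].
  move=> s t _ _; exists (s ++ t) => // u su; split=> x xs; apply: su;
    by rewrite mem_cat xs ?orbT.
pose P (s : seq G) (a : G) := exists2 b, b \in s & forall x, `|f (x + (a - b)) - f x| <= e.
have [s _ sP] : \near Fl, [set: G] `<=` P Fl.
  apply: cov => x _.
  have cx : (y - x) @[y --> x] --> (0 : G).
    rewrite -(subrr x).
    apply: (@continuous_comp _ _ _ (fun a => (a, x)) (fun x : G * G => x.1 - x.2)).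
      by apply: cvg_pair; [exact: cvg_id|exact: cvg_cst].
    exact: sub_continuous.
  exists ([set y | forall z, `|f (z + (y - x)) - f z| <= e], [set t : seq G | x \in t]).
    split; first exact: (cx _ (uniformly_continuous cf e0)).
    by exists [:: x] => // t /=; apply; exact: mem_head.
  by move=> [y t] /= [yP xt]; exists x.
by exists s => a; exact: (sP s).
Qed.

(** Continuity at 0 of the real part suffices, as |chi(v) - 1|^2 = 2 (1 - p(v)). *)
Lemma character_of_dAlembert (p s : G -> R) :
  p 0 = 1 ->
  (forall x y, p (x + y) = p x * p y - s x * s y) ->
  (forall x y, s (x + y) = s x * p y + p x * s y) ->
  (forall x, p x ^+ 2 + s x ^+ 2 = 1) ->
  (forall e : R, 0 < e -> \forall v \near (0 : G), 1 - p v <= e) ->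
  is_continuous_character (fun x => Complex (p x) (s x) : Cplx R).
Proof.
move=> p0 pM sM ps pc; pose chi x := Complex (p x) (s x) : Cplx R.
have chiM x y : chi (x + y) = chi x * chi y.
  by rewrite /chi pM sM; apply/eqP; rewrite eq_complex /= !eqxx /= addrC eqxx.
have chi1 x : `|chi x| = 1.
  by rewrite normc_def /= ps sqrtr1.
split; first by split=> // x; exact: chi1.
move=> x; apply/cvgrPdist_le => /= eps eps0.
have [e e0 ->] : exists2 e : R, 0 < e & eps = e%:C%C.
  by move: (eps : R[i]%C) (eps0 : 0 < (eps : R[i]%C)) => [a b]; rewrite ltcE /= => /andP[/eqP -> a0]; exists a.
have cx : (y - x) @[y --> x] --> (0 : G).
  rewrite -(subrr x).
  apply: (@continuous_comp _ _ _ (fun a => (a, x)) (fun x : G * G => x.1 - x.2)).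
    by apply: cvg_pair; [exact: cvg_id|exact: cvg_cst].
  exact: sub_continuous.
have U : nbhs x [set y | 1 - p (y - x) <= e ^+ 2 / 2].
  by apply: (cx _ (pc _ _)); rewrite divr_gt0// exprn_gt0.
apply: filterS U => y /= h.
rewrite -/(chi x) -/(chi y) (_ : chi x - chi y = (1 - chi (y - x)) * chi x); last first.
  by rewrite mulrBl mul1r -chiM subrK.
rewrite normrM chi1 mulr1.
rewrite normc_def lecE /= eqxx /= -[leRHS](ger0_norm (ltW e0)) -sqrtr_sqr.
apply: ler_wsqrtr.
by have := ps (y - x); lra.
Qed.

(** The continuous characters of a compact Hausdorff abelian group separate its
    points. *)
Theorem dual_separates (g : G) : g != 0 -> exists chi : dual R G, chi g != 1.
Proof.
move=> g0.
have [f [fc f01 f0 fg]] : exists f : G -> R, [/\ continuous f, range f `<=` `[0, 1]%classic,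
    f @` [set 0] `<=` [set 0] & f @` [set g] `<=` [set 1]].
  apply/uniform_separatorP.
  have /(@normal_separatorP R) : normal_space G by exact: compact_normal.
  have acc := hausdorff_accessible G_hausdorff.
  apply; [exact: (accessible_closed_set1 acc)|exact: (accessible_closed_set1 acc)|].
  by apply/disjoints_subset => x -> /= /esym/eqP; exact/negP.
have {}f0 : f 0 = 0 by apply: f0; exists 0.
have {}fg : f g = 1 by apply: fg; exists g.
have fB x : `|f x| <= 1.
  have /= := f01 _ (imageT f x); rewrite in_itv /= ler_norml; lra.
pose h x := f (x + g) - f x.
have hB x : `|h x| <= 2.
  by apply: le_trans (ler_normB _ _) _; rewrite -[2]/(1 + 1 : R) lerD.
have hc : continuous h.
  move=> x; apply: (@continuousB R R G (fun z => f (z + g)) f); last exact: fc.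
  apply: (@continuous_comp _ _ _ (fun z => z + g) f); last exact: fc.
  apply: (@continuous_comp _ _ _ (fun a => (a, g)) (fun x : G * G => x.1 + x.2)).
    by apply: cvg_pair; [exact: cvg_id|exact: cvg_cst].
  exact: add_continuous.
have hap := continuous_almost_periodic hc.
have [phi hphi] := correlation_exists hap.
have h0 : h 0 != 0 by rewrite /h add0r fg f0 subr0 oner_neq0.
have phi0 := correlation_gt0 hap hphi h0.
have phiap : almost_periodic phi.
  apply: (@almost_periodic_dom _ _ h _ 2) => // e v _ hv.
  exact: correlation_shift hB hphi _ _ hv.
have phiM := correlation_posdefM hphi.
have [d d0 dP] := diffsum_sqr_lb phiap phi0.
have phipd : posdef phi.
  rewrite (_ : phi = fun x => phi x * 1); last by apply/funext => x; rewrite mulr1.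
  apply: phiM; split=> // w; rewrite /pdform.
  rewrite (_ : \sum_(i <- w) _ = (\sum_(i <- w) i.1) ^+ 2) ?sqr_ge0//.
  rewrite expr2 mulr_suml; apply: eq_bigr => i _; rewrite mulr_sumr.
  by apply: eq_bigr => j _; rewrite mulr1.
(* The normalization of phi is a state of positive mean value. *)
pose q x := (phi 0)^-1 * phi x.
have Kq : states q.
  split; last by rewrite /q mulVf// gt_eqF.
  split=> [x|w]; first by rewrite /q phipd.1.
  rewrite pdformZ; apply: mulr_ge0; last exact: phipd.2.
  by rewrite invr_ge0 ltW.
have [p [Kp qp pext]] := meanval_extreme phiM Kq.
pose delta := (phi 0)^-1 * d; have delta0 : 0 < delta by rewrite mulr_gt0// invr_gt0.
have pP s : s != [::] -> delta * (size s)%:R ^+ 2 <= diffsum (fun x => phi x * p x) s.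
  move=> s0; apply: le_trans (meanval_le phiM Kp.1 s0).
  apply: ler_wpM2r; first exact: sqr_ge0.
  apply: le_trans qp; apply: meanval_ge => t t0.
  rewrite (_ : diffsum _ _ = (phi 0)^-1 * diffsum (fun x => phi x ^+ 2) t).
    by rewrite -mulrA ler_pM2l ?invr_gt0.
  rewrite /diffsum mulr_sumr; apply: eq_bigr => a _; rewrite mulr_sumr.
  by apply: eq_bigr => b _; rewrite /q; lra.
have dA := extreme_dAlembert Kp pext.
have [[pN _] p0] := Kp.
have p1 x : `|p x| <= 1 by rewrite -p0; exact: posdef_bound Kp.1.
have pg : p g != 1 by exact: (dAlembert_separates p0 pN dA delta0 fB hphi pP).
have [s [pM sM ps]] := Kannappan p0 pN p1 dA.
have pc e : 0 < e -> \forall v \near (0 : G), 1 - p v <= e.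
  move=> e0; have := uniformly_continuous hc (e := e * delta / 2) ltac:(by rewrite divr_gt0// mulr_gt0).
  apply: filterS => v hv.
  have := dAlembert_modulus p1 dA _ _ (correlation_shift hB hphi hv) pP.
  move=> /(_ (phi 0)) h1; rewrite -(ler_pM2l delta0).
  apply: le_trans (h1 _ _) _; last by lra.
    by rewrite mulr_ge0// divr_ge0// mulr_ge0 ?ltW.
  by move=> x; exact: posdef_bound.
exists (Dual (character_of_dAlembert p0 pM sM ps pc)) => /=.
by apply: contra pg; rewrite eq_complex /= => /andP[].
Qed.
End Separation.

(** * Hermitian bicharacters trivial on their isotropy group *)

Section Bichar.
Variables (R : realType) (A : zmodType) (u : A -> A -> Cplx R).
Hypotheses (ub : bicharacter u) (uh : hermitian_bichar u)
  (und : nondegenerate_bichar u).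

Lemma bichar_normE a b : `|u a b| = 1.
Proof. by have [_ /(_ a)[h _]] := ub; exact: h. Qed.

Lemma bicharDl a b c : u (a + b) c = u a c * u b c.
Proof. by have [/(_ c)[_ h] _] := ub; exact: h. Qed.

Lemma bicharDr a b c : u a (b + c) = u a b * u a c.
Proof. by have [_ /(_ a)[_ h]] := ub; exact: h. Qed.

Lemma bichar_neq0 a b : u a b != 0.
Proof. by rewrite -normr_eq0 bichar_normE oner_eq0. Qed.

Lemma bichar0l b : u 0 b = 1.
Proof. by apply: (mulfI (bichar_neq0 0 b)); rewrite -bicharDl addr0 mulr1. Qed.

Lemma bichar0r a : u a 0 = 1.
Proof. by apply: (mulfI (bichar_neq0 a 0)); rewrite -bicharDr addr0 mulr1. Qed.

Lemma bicharMnl a b n : u (a *+ n) b = u a b ^+ n.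
Proof. by elim: n => [|n IH]; rewrite ?bichar0l// mulrS bicharDl IH exprS. Qed.

Lemma bicharMnr a b n : u a (b *+ n) = u a b ^+ n.
Proof. by elim: n => [|n IH]; rewrite ?bichar0r// mulrS bicharDr IH exprS. Qed.

Lemma bichar_swap a b : u a b * u b a = 1.
Proof. by rewrite (uh b a) -normCK bichar_normE expr1n. Qed.

(** Since u(a,b) and u(b,a) are mutually inverse, the diagonal is additive. *)
Lemma bichar_diagD a b : u (a + b) (a + b) = u a a * u b b.
Proof. by rewrite bicharDl !bicharDr -mulrA [u a b * _]mulrA bichar_swap mul1r. Qed.

Lemma bichar_diag a : u a a = 1 \/ u a a = -1.
Proof.
have /eqP := bichar_swap a a; rewrite -expr2 sqrf_eq1.
by case/orP => /eqP; [left|right].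
Qed.

Lemma bichar_nondeg a : (forall b, u a b = 1) -> a = 0.
Proof. by move=> h; have : [set a | forall b, u a b = 1] a by []; rewrite und.1. Qed.

Hypothesis uiso : forall a b, isotropy u a -> isotropy u b -> u a b = 1.

Section NonIsotropic.
Variable s : A.
Hypothesis us : u s s = -1.

Lemma isotropy_coset a : u a a = 1 \/ u (a + s) (a + s) = 1.
Proof.
case: (bichar_diag a) => ua; first by left.
by right; rewrite bichar_diagD ua us mulrNN mulr1.
Qed.

(** The pairing with s is injective on the isotropy group. *)
Lemma isotropy_inj a : u a a = 1 -> u a s = 1 -> a = 0.
Proof.
move=> ua uas; apply: bichar_nondeg => b.
case: (isotropy_coset b) => ubb; first exact: uiso.
by have := uiso ua ubb; rewrite bicharDr uas mulr1.
Qed.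

Lemma nonisotropic_double : s + s = 0.
Proof.
apply: isotropy_inj; first by rewrite bichar_diagD us mulrNN mulr1.
by rewrite bicharDl us mulrNN mulr1.
Qed.

Lemma isotropy_pairing a : u a a = 1 -> u a s = 1 \/ u a s = -1.
Proof.
move=> ua; have /eqP : u a s ^+ 2 = 1.
  by rewrite -bicharMnr mulr2n nonisotropic_double bichar0r.
by rewrite sqrf_eq1 => /orP[] /eqP; [left|right].
Qed.

Lemma isotropy_double a : u a a = 1 -> a + a = 0.
Proof.
move=> ua; apply: isotropy_inj; first by rewrite bichar_diagD ua mulr1.
by rewrite bicharDl; case: (isotropy_pairing ua) => ->; rewrite ?mulr1 ?mulrNN ?mulr1.
Qed.

(** The isotropy group has at most one nonzero element, since all of them have the
    same pairing -1 with s. *)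
Lemma isotropy_uniq a e : u a a = 1 -> u e e = 1 -> a != 0 -> e != 0 -> a = e.
Proof.
have neq0 b : u b b = 1 -> b != 0 -> u b s = -1.
  move=> ubb b0; case: (isotropy_pairing ubb) => // ubs.
  by move: b0; rewrite (isotropy_inj ubb ubs) eqxx.
move=> ua ue a0 e0; apply/eqP; rewrite -subr_eq0.
have -> : - e = e by apply/eqP; rewrite eq_sym -addr_eq0 isotropy_double.
apply/eqP; apply: isotropy_inj; first by rewrite bichar_diagD ua ue mulr1.
by rewrite bicharDl !neq0// mulrNN mulr1.
Qed.

End NonIsotropic.
End Bichar.

(** * Homomorphisms from Z/2 and finite targets *)

Lemma Z2_cases (P : 'Z_2 -> Prop) : P 0 -> P 1 -> forall m, P m.
Proof.
move=> P0 P1 [[|[|//]] i].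
  by rewrite (_ : Ordinal i = 0)//; exact/val_inj.
by rewrite (_ : Ordinal i = 1)//; exact/val_inj.
Qed.

Section Z2Morphisms.
Variables (A : zmodType).

Lemma Z2_morphism (a : A) : a + a = 0 ->
  exists f : {additive 'Z_2 -> A}, forall m, f m = a *+ m.
Proof.
move=> aa; have fM : zmod_morphism (fun m : 'Z_2 => a *+ m).
  have aN : - a = a by apply/eqP; rewrite eq_sym -addr_eq0 aa.
  by apply: Z2_cases; apply: Z2_cases; rewrite /= ?mulr0n ?mulr1n ?subrr ?sub0r ?aN ?subr0.
pose m := GRing.isZmodMorphism.Build _ _ _ fM.
by exists (HB.pack_for {additive 'Z_2 -> A} (fun m : 'Z_2 => a *+ m) m).
Qed.

Lemma Z2xZ2_morphism (a b : A) : a + a = 0 -> b + b = 0 ->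
  exists f : {additive 'Z_2 * 'Z_2 -> A}, forall m, f m = a *+ m.1 + b *+ m.2.
Proof.
move=> /Z2_morphism[f fE] /Z2_morphism[g gE].
have fM : zmod_morphism (fun m : 'Z_2 * 'Z_2 => f m.1 + g m.2).
  by move=> x y /=; rewrite !raddfB opprD addrACA.
pose m := GRing.isZmodMorphism.Build _ _ _ fM.
by exists (HB.pack_for {additive 'Z_2 * 'Z_2 -> A} (fun m : 'Z_2 * 'Z_2 => f m.1 + g m.2) m) => n /=; rewrite fE gE.
Qed.
End Z2Morphisms.

(** A finite subspace of a Hausdorff space is discrete. *)
Lemma finite_within_continuous (H T : topologicalType) (S : set H) (g : H -> T) :
  hausdorff_space H -> finite_set S -> {within S, continuous g}.
Proof.
move=> hH fS; apply/subspace_continuousP => x Sx N Ng.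
have cl : closed (S `\ x).
  apply: (@accessible_finite_set_closed H).1; first exact: hausdorff_accessible.
  exact: finite_setD.
have nb : nbhs x (~` (S `\ x)).
  by apply: open_nbhs_nbhs; split; [exact: closed_openC|move=> [_]; apply].
apply: filterS nb => y /= nSy Sy.
have -> : y = x by apply: contrapT => yx; apply: nSy; split.
exact: nbhs_singleton.
Qed.

Lemma topgroup_isom_finite (G : topologicalZmodType) (H : topologicalType)
    (mul : H -> H -> H) (S : set H) (f : G -> H) :
  hausdorff_space H -> finite_set S -> continuous f ->
  {morph f : x y / x + y >-> mul x y} -> injective f -> range f = S ->
  topgroup_isom G mul S.
Proof.
move=> hH fS fc fM fI fE.
have /choice[g gP] : forall z, exists x, S z -> f x = z.
  move=> z; have [|nS] := pselect (S z); last by exists 0.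
  by rewrite -fE => -[x _ <-]; exists x.
exists f, g; split=> //.
- by move=> x _; rewrite -fE; exact: imageT.
- by move=> x; apply: fI; apply: gP; rewrite -fE; exact: imageT.
- by move=> z /set_mem; exact: gP.
- by split=> //; exact: finite_within_continuous.
Qed.

Section Dual.
Variables (R : realType) (G : topologicalZmodType).
Hypotheses (G_compact : compact [set: G]) (G_hausdorff : hausdorff_space G).
Implicit Types s : dual R G.

Lemma dualD s x y : s (x + y) = s x * s y.
Proof. by have [[_ h] _] := dualP s; exact: h. Qed.

Lemma dual_continuous s : continuous s.
Proof. by have [] := dualP s. Qed.

Lemma dual0 s : s 0 = 1.
Proof. by apply: (mulfI (dual_fun_neq0 s 0)); rewrite -dualD addr0 mulr1. Qed.

(** Points with the same characters coincide. *)
Lemma dual_inj x y : (forall s, s x = s y) -> x = y.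
Proof.
move=> h; apply/eqP; rewrite -subr_eq0; apply: contrapT => /negP xy.
have [s /eqP] := dual_separates R G_compact G_hausdorff xy; apply.
by apply: (mulIf (dual_fun_neq0 s y)); rewrite -dualD subrK mul1r.
Qed.

Lemma dual_sign s x : s + s = 0 -> s x = 1 \/ s x = -1.
Proof.
move=> /(congr1 (fun t : dual R G => t x)) /= /eqP; rewrite -expr2 sqrf_eq1.
by case/orP => /eqP; [left|right].
Qed.

Lemma dual_neq0 s : s + s = 0 -> s != 0 -> exists x, s x = -1.
Proof.
move=> ss /eqP s0; apply: contrapT => /forallNP h; apply: s0.
by apply: dual_eqP => x /=; case: (dual_sign x ss) => // /h.
Qed.

End Dual.

(** * The Fermi and Klein models *)

Section Models.
Variables (R : realType).

Lemma Cplx_neqN11 : (-1 : Cplx R) != 1.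
Proof. by rewrite eq_sym -addr_eq0 -mulr2n pnatr_eq0. Qed.

Section Bichar.
Variables (A : zmodType) (u : A -> A -> Cplx R).
Hypothesis ub : bicharacter u.

Lemma bichar_equiv_refl (B : zmodType) (v w : B -> B -> Cplx R) :
  (forall m n, v m n = w m n) -> bichar_equiv v w.
Proof. by move=> vw; exists (idfun : {additive B -> B}); first exact: inv_bij. Qed.

Lemma fermi_equiv (s : A) : u s s = -1 -> s + s = 0 ->
  (forall a, a = 0 \/ a = s) -> bichar_equiv_upto_iso u (@fermi_bichar R).
Proof.
move=> us ss cover; have [f fE] := Z2_morphism ss.
exists f; last first.
  by apply: bichar_equiv_refl => m n; rewrite !fE bicharMnl// bicharMnr// us -exprM mulnC.
have s0 : s != 0.
  by apply: contra_neq Cplx_neqN11 => s0; rewrite -us s0 bichar0l.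
exists (fun a => if a == 0 then 0 else 1) => [|a].
  by apply: Z2_cases; rewrite fE ?mulr0n ?mulr1n ?eqxx ?(negbTE s0).
by case: (cover a) => ->; rewrite ?eqxx ?(negbTE s0) fE.
Qed.

Lemma klein_equiv (s t : A) : u s s = -1 -> u t t = -1 -> u s t = 1 -> u t s = 1 ->
  s + s = 0 -> t + t = 0 -> (forall a, [\/ a = 0, a = s, a = t | a = s + t]) ->
  bichar_equiv_upto_iso u (@klein_bichar R).
Proof.
move=> us ut ust uts ss tt cover; have [f fE] := Z2xZ2_morphism ss tt.
have uf m n : u (f m) (f n) = klein_bichar R m n.
  rewrite !fE bicharDl// !bicharDr// !bicharMnl// !bicharMnr//.
  rewrite us ut ust uts !expr1n mul1r mulr1 -!exprM -exprD.
  by rewrite /klein_bichar [(m.1 * _)%N]mulnC [(m.2 * _)%N]mulnC.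
exists f; last exact: bichar_equiv_refl.
have us_f m : u (f m) s = (-1) ^+ m.1.
  by rewrite fE bicharDl// !bicharMnl// us uts expr1n mulr1.
have ut_f m : u (f m) t = (-1) ^+ m.2.
  by rewrite fE bicharDl// !bicharMnl// ut ust expr1n mul1r.
pose g a : 'Z_2 * 'Z_2 := (if u a s == 1 then 0 else 1, if u a t == 1 then 0 else 1).
have fK : cancel f g.
  move=> [m n]; rewrite /g us_f ut_f /=; congr (_, _).
    by move: m; apply: Z2_cases; rewrite ?expr0 ?expr1 ?eqxx ?(negbTE Cplx_neqN11).
  by move: n; apply: Z2_cases; rewrite ?expr0 ?expr1 ?eqxx ?(negbTE Cplx_neqN11).
exists g => // a.
have fP m : f (g (f m)) = f m by rewrite fK.
(* Each element is a value of f, so cancellation on the other side suffices. *)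
case: (cover a) => ->.
- by have := fP (0, 0); rewrite !fE /= !mulr0n addr0.
- by have := fP (1, 0); rewrite [X in _ = X -> _]fE [f (1, 0)]fE /= mulr0n mulr1n addr0.
- by have := fP (0, 1); rewrite [X in _ = X -> _]fE [f (0, 1)]fE /= mulr0n mulr1n add0r.
- by have := fP (1, 1); rewrite [X in _ = X -> _]fE [f (1, 1)]fE /= !mulr1n.
Qed.
End Bichar.

Section Groups.
Variable G : topologicalZmodType.
Hypotheses (G_compact : compact [set: G]) (G_hausdorff : hausdorff_space G).

Lemma isom_Z2 (s : dual R G) : s != 0 -> s + s = 0 ->
  (forall t : dual R G, t = 0 \/ t = s) ->
  topgroup_isom G (fun x y : Cplx R => x * y) (mulZ2 R).
Proof.
move=> s0 ss cover; apply: (@topgroup_isom_finite _ _ _ _ s).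
- exact: norm_hausdorff.
- exact: finite_set2.
- exact: dual_continuous.
- exact: dualD.
- move=> x y sxy; apply: (@dual_inj R G G_compact G_hausdorff) => t.
  by case: (cover t) => ->.
- apply/seteqP; split=> [_ [x _ <-]|z [|] ->]; first exact: dual_sign.
    by exists 0 => //; exact: dual0.
  by have [x sx] := dual_neq0 ss s0; exists x.
Qed.

(** The image of x |-> (s(x), t(x)) is a subgroup of {1,-1}^2 on which neither of
    the projections nor their product is trivial, so it is everything. *)
Lemma isom_Klein (s t : dual R G) : s != 0 -> t != 0 -> s + t != 0 ->
  s + s = 0 -> t + t = 0 ->
  (forall r : dual R G, [\/ r = 0, r = s, r = t | r = s + t]) ->
  topgroup_isom G (fun x y : Cplx R * Cplx R => (x.1 * y.1, x.2 * y.2))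
    (mulZ2 R `*` mulZ2 R).
Proof.
move=> s0 t0 st0 ss tt cover.
(* Both generators of the target are attained. *)
have [a [sa ta] [b sb tb]] : exists2 a, s a = -1 /\ t a = 1 &
    exists2 b, s b = 1 & t b = -1.
  have stst : (s + t) + (s + t) = 0 by rewrite addrACA ss tt addr0.
  have [x sx] := dual_neq0 ss s0; have [y ty] := dual_neq0 tt t0.
  have [z stz] := dual_neq0 stst st0.
  have {}stz : s z * t z = -1 by [].
  case: (dual_sign x tt) => tx.
    exists x => //; case: (dual_sign y ss) => sy; first by exists y.
    exists (x + y); first by rewrite dualD sx sy mulrNN mulr1.
    by rewrite dualD tx ty mul1r.
  case: (dual_sign z ss) => sz; rewrite sz in stz.
    rewrite mul1r in stz; exists (x + z); last by exists z.
    by rewrite !dualD sx sz tx stz mulr1 mulrNN mulr1.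
  rewrite mulN1r in stz; have {}stz := oppr_inj stz.
  exists z => //; exists (x + z).
    by rewrite dualD sx sz mulrNN mulr1.
  by rewrite dualD tx stz mulr1.
apply: (@topgroup_isom_finite _ _ _ _ (fun x => (s x, t x))).
- exact: norm_hausdorff.
- by apply: finite_setX; exact: finite_set2.
- by move=> x; apply: (cvg_pair (dual_continuous (x := x)) (dual_continuous (x := x))).
- by move=> x y /=; rewrite !dualD.
- move=> x y [sxy txy]; apply: (@dual_inj R G G_compact G_hausdorff) => r.
  by case: (cover r) => -> //=; rewrite sxy txy.
- apply/seteqP; split=> [_ [x _ <-]|[z w] [] /=].
    by split; exact: dual_sign.
  case=> ->; case=> ->.
  + by exists 0 => //; rewrite !dual0.
  + by exists b => //; rewrite sb tb.
  + by exists a => //; rewrite sa ta.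
  + by exists (a + b) => //; rewrite !dualD sa sb ta tb mulr1 mul1r.
Qed.
End Groups.
End Models.

Theorem theorem5p1 (R : realType) (G : topologicalZmodType)
    (G_compact : compact [set: G]) (G_hausdorff : hausdorff_space G)
    (u : dual R G -> dual R G -> Cplx R)
    (u_bichar : bicharacter u) (u_herm : hermitian_bichar u)
    (u_nondeg : nondegenerate_bichar u)
    (u_isotropy : forall s t : dual R G,
      isotropy u s -> isotropy u t -> u s t = 1) :
  [\/ [/\ forall g : G, g = 0,
          forall s : dual R G, s = 0 &
          forall s t : dual R G, u s t = 1],
      topgroup_isom G (fun x y : Cplx R => x * y) (mulZ2 R) /\
        bichar_equiv_upto_iso u (@fermi_bichar R) |
      topgroup_isom G (fun x y : Cplx R * Cplx R => (x.1 * y.1, x.2 * y.2))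
          (mulZ2 R `*` mulZ2 R) /\
        bichar_equiv_upto_iso u (@klein_bichar R)].
Proof.
have [iso|/existsNP[s us1]] := pselect (forall s, u s s = 1).
  have u1 s t : u s t = 1 by apply: u_isotropy; exact: iso.
  have dual_triv (s : dual R G) : s = 0.
    by apply: (bichar_nondeg u_nondeg) => t; exact: u1.
  constructor 1; split=> // g; apply: (@dual_inj R G G_compact G_hausdorff) => s.
  by rewrite (dual_triv s) dual0.
have us : u s s = -1 by case: (bichar_diag u_bichar u_herm s).
have ss := nonisotropic_double u_bichar u_herm u_nondeg u_isotropy us.
have neq0 t : u t t = -1 -> t != 0.
  move=> ut; apply: contra_neq (Cplx_neqN11 R) => t0.
  by rewrite -ut t0 bichar0l.
have s0 := neq0 _ us.
have coset := isotropy_coset u_bichar u_herm us.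
have [triv|/existsNP[e /not_implyP[ue /eqP e0]]] := pselect (forall a, u a a = 1 -> a = 0).
  have cover a : a = 0 \/ a = s.
    case: (coset a) => [/triv|/triv/eqP]; first by left.
    by rewrite addr_eq0 => /eqP ->; right; apply/eqP; rewrite eq_sym -addr_eq0 ss.
  constructor 2; split; first exact: isom_Z2 cover.
  exact: fermi_equiv cover.
have ee := isotropy_double u_bichar u_herm u_nondeg u_isotropy us ue.
have ues : u e s = -1.
  case: (isotropy_pairing u_bichar u_herm u_nondeg u_isotropy us ue) => // ues.
  by move: e0; rewrite (isotropy_inj u_bichar u_herm u_nondeg u_isotropy us ue ues) eqxx.
have use : u s e = -1.
  by have := bichar_swap u_bichar u_herm s e; rewrite ues mulrN1 => /eqP; rewrite eqr_oppLR => /eqP.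
have isoE a : u a a = 1 -> a = 0 \/ a = e.
  have [->|a0] := eqVneq a 0; [by left|right].
  exact: (isotropy_uniq u_bichar u_herm u_nondeg u_isotropy us).
(* s and s + e are orthogonal for u and both have diagonal value -1. *)
pose t := s + e.
have tt : t + t = 0 by rewrite /t addrACA ss ee addr0.
have ut : u t t = -1 by rewrite bichar_diagD// us ue mulr1.
have st : s + t = e by rewrite /t addrA ss add0r.
have cover a : [\/ a = 0, a = s, a = t | a = s + t].
  have Ns : - s = s by apply/eqP; rewrite eq_sym -addr_eq0 ss.
  case: (coset a) => /isoE[] => [->|->|/eqP|h]; [by constructor 1|by rewrite st; constructor 4| |].
    by rewrite addr_eq0 Ns => /eqP ->; constructor 2.
  by constructor 3; rewrite /t addrC -h -addrA ss addr0.
constructor 3; split.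
  by apply: isom_Klein cover => //; [exact: neq0|rewrite st].
apply: klein_equiv cover => //.
  by rewrite bicharDr// us use mulrNN mulr1.
by rewrite bicharDl// us ues mulrNN mulr1.
Qed.
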